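(* Let $(R,\mathfrak{m},K)$ be either a Noetherian local ring with maximal ideal $\mathfrak{m}$ and residue field $K$, or a Noetherian standard graded $K$-algebra over a field $K$ with unique graded maximal ideal $\mathfrak{m}$; assume that $K$ is infinite and $\mathrm{depth}\,R>0$. The following assertions are equivalent (where each of (c)--(f) may be read either with ''for every reduction $I$ of $\mathfrak{m}$'' or with ''for every minimal reduction $I$ of $\mathfrak{m}$'', both readings giving equivalent conditions): (a) $R$ is regular; (b) $\mathfrak{m}$ is generated by a $d$-sequence; (c) $s(\mathfrak{m})=1$ and $\mathrm{r}_I(\mathfrak{m})=0$ for every (minimal) reduction $I$ of $\mathfrak{m}$; (d) $\mathfrak{d}_1(I)=\mathfrak{d}_2(I)=\mathfrak{d}_3(I)=0$ for every (minimal) reduction $I$ of $\mathfrak{m}$; (e) $\mathfrak{d}_3(I)=0$ for every (minimal) reduction $I$ of $\mathfrak{m}$; (f) $\mathcal{R}(\mathfrak{m},I)=(\mathcal{R}(\mathfrak{m},I)_{\ge1}:_{\mathcal{R}(R)}\mathfrak{m})(1)$ for every (minimal) reduction $I$ of $\mathfrak{m}$.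
   Context: Rings are commutative, Noetherian, unital. $\mathrm{depth}\,R>0$ means that $\mathfrak{m}$ contains a non-zerodivisor of $R$. If $R$ is graded, the ideals $I$ considered are assumed homogeneous. Full properties: an ideal $L$ of $R$ is $\mathfrak{m}$-full if $L\mathfrak{m}:x=L$ for some $x\in\mathfrak{m}\setminus\mathfrak{m}^2$; full if $L:x=L:\mathfrak{m}$ for some $x\in\mathfrak{m}\setminus\mathfrak{m}^2$; weakly $\mathfrak{m}$-full if $L\mathfrak{m}:\mathfrak{m}=L$. The Dao numbers $\mathfrak{d}_1(I),\mathfrak{d}_2(I),\mathfrak{d}_3(I)$ of an ideal $I$ are the minimal $t\ge0$ such that $I\mathfrak{m}^k$ is, respectively, $\mathfrak{m}$-full, full, weakly $\mathfrak{m}$-full for all $k\ge t$. Reductions: an ideal $I\subset \mathfrak{m}$ is a reduction of $\mathfrak{m}$ if $I\mathfrak{m}^r=\mathfrak{m}^{r+1}$ for some $r\ge0$; it is minimal if it is minimal with respect to inclusion among reductions. The reduction number is $\mathrm{r}_I(\mathfrak{m})=\min\{n\ge0\mid I\mathfrak{m}^n=\mathfrak{m}^{n+1}\}$. Ratliff-Rush closure: for an ideal $L$, $\widetilde{L}=\bigcup_{n\ge1}(L^{n+1}:L^n)$. Since $\mathfrak{m}$ contains a regular element, $\widetilde{\mathfrak{m}^n}=\mathfrak{m}^n$ for $n\gg0$, and $s(\mathfrak{m})=\min\{n\ge1\mid \widetilde{\mathfrak{m}^i}=\mathfrak{m}^i\text{ for all } i\ge n\}$. $d$-sequence: $x_1,\dots,x_m\in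 R$ is a $d$-sequence if no $x_i$ lies in the ideal generated by the others, $0:_Rx_1x_j=0:_Rx_j$ for $j=1,\dots,m$, and $(x_1,\dots,x_i):_Rx_{i+1}x_j=(x_1,\dots,x_i):_Rx_j$ for $i=1,\dots,m-1$ and $j=i+1,\dots,m$. Graded structures: $\mathcal{R}(\mathfrak{m})=\bigoplus_{k\ge0}\mathfrak{m}^k$ is the Rees algebra of $\mathfrak{m}$, contained in $\mathcal{R}(R)=\bigoplus_{k\ge0}R$ (that is, $R[T]$); $\mathcal{R}(\mathfrak{m},I)=\bigoplus_{k\ge0}I\mathfrak{m}^k$ and $\mathcal{R}(\mathfrak{m},I)_{\ge1}=\bigoplus_{k\ge1}I\mathfrak{m}^k$. The module $\mathcal{R}(\mathfrak{m},I)_{\ge1}:_{\mathcal{R}(R)}\mathfrak{m}$ consists of the elements $f\in\mathcal{R}(R)$ with $\mathfrak{m}f\subset\mathcal{R}(\mathfrak{m},I)_{\ge1}$, where $\mathfrak{m}\subset R$ sits in degree $0$; its degree-$k$ component is $I\mathfrak{m}^k:\mathfrak{m}$ for $k\ge1$ and $0:\mathfrak{m}=0$ for $k=0$. For a graded module $N$, $N(1)_k=N_{k+1}$; so the degree-$k$ component of the right-hand side in (f) is $I\mathfrak{m}^{k+1}:\mathfrak{m}$ for $k\ge0$. *)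

(* Defs.v *)
From HB Require Import structures.
From mathcomp Require Import all_boot all_order all_algebra.
From mathcomp Require Import boolp classical_sets functions cardinality.

Set Implicit Arguments.
Unset Strict Implicit.
Unset Printing Implicit Defensive.

Import GRing.Theory.
Local Open Scope classical_set_scope.
Local Open Scope ring_scope.

(* Ideals are Prop-valued sets, and the unit ideal is an
   ideal: colon ideals and the power m^0 need it (the [idealr] structures of
   ring_quotient are boolean and restricted to proper ideals). *)

Definition least (P : nat -> Prop) (n : nat) : Prop :=
  P n /\ forall k, P k -> (n <= k)%N.

Section Ideals.
Context {R : comNzRingType}.
Implicit Types (I J L P m : set R) (A : set R) (s : seq R) (x : R).

Definition is_ideal I : Prop :=
  [/\ I 0, forall a b, I a -> I b -> I (a + b) & forall r a, I a -> I (r * a)].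

Definition ideal_gen A : set R := smallest is_ideal A.

Definition ideal_mul I J : set R := ideal_gen [set a * b | a in I & b in J].

Definition ideal_exp I (n : nat) : set R := iter n (ideal_mul I) setT.

Definition colon L J : set R := [set a | forall b, J b -> L (a * b)].

Definition colon_elt L x : set R := [set a | L (a * x)].

Definition prime_ideal P : Prop :=
  [/\ is_ideal P, ~ P 1 & forall a b, P (a * b) -> P a \/ P b].

Definition maximal_ideal m : Prop :=
  [/\ is_ideal m, ~ m 1 & forall J, is_ideal J -> m `<=` J -> ~ J 1 -> J = m].

Definition residue_classes m : set (set R) :=
  [set [set b | m (b - a)] | a in setT].

Definition depth_gt0 m : Prop :=
  exists2 x, m x & forall y, x * y = 0 -> y = 0.

Definition prime_chain P (n : nat) : Prop :=
  exists c : nat -> set R,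
    [/\ forall i, (i <= n)%N -> prime_ideal (c i),
        forall i, (i < n)%N -> c i `<` c i.+1
      & c n = P].

Definition has_height P (n : nat) : Prop :=
  prime_chain P n /\ forall k, prime_chain P k -> (k <= n)%N.

(* The localization R_P is a regular local ring: its maximal ideal P R_P is
   generated by dim R_P = height P elements.  Generators of P R_P may be taken
   in P, and a/1 lies in s R_P iff u * a lies in (s) for some u outside P. *)
Definition regular_at P : Prop :=
  exists s, [/\ has_height P (size s), [set` s] `<=` P
    & forall a, P a -> exists2 u, ~ P u & ideal_gen [set` s] (u * a)].

Definition m_full m L : Prop :=
  exists x, [/\ m x, ~ ideal_exp m 2 x & colon_elt (ideal_mul L m) x = L].

Definition full m L : Prop :=
  exists x, [/\ m x, ~ ideal_exp m 2 x & colon_elt L x = colon L m].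

Definition weakly_m_full m L : Prop := colon (ideal_mul L m) m = L.

Definition dao_number (prop : set R -> set R -> Prop) m I (d : nat) : Prop :=
  least (fun t => forall k, (t <= k)%N -> prop m (ideal_mul I (ideal_exp m k)))
        d.

Definition dao1 := dao_number m_full.
Definition dao2 := dao_number full.
Definition dao3 := dao_number weakly_m_full.

(* [adm] is the class of ideals under consideration: all ideals in the local
   case, the homogeneous ones in the graded case. *)
Definition reduction (adm : set (set R)) m I : Prop :=
  [/\ adm I, I `<=` m
    & exists r, ideal_mul I (ideal_exp m r) = ideal_exp m r.+1].

Definition minimal_reduction (adm : set (set R)) m I : Prop :=
  reduction adm m I /\ forall J, reduction adm m J -> J `<=` I -> J = I.

Definition reduction_number m I (n : nat) : Prop :=
  least (fun r => ideal_mul I (ideal_exp m r) = ideal_exp m r.+1) n.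

Definition ratliff_rush L : set R :=
  \bigcup_(n in [set n | (1 <= n)%N]) colon (ideal_exp L n.+1) (ideal_exp L n).

Definition s_number m (n : nat) : Prop :=
  least (fun n => (1 <= n)%N /\ forall i, (n <= i)%N ->
           ratliff_rush (ideal_exp m i) = ideal_exp m i) n.

(* With 0-based indices; i = 0 in the last clause is 0 : x_1 x_j = 0 : x_j. *)
Definition d_sequence s : Prop :=
  (forall i, (i < size s)%N ->
     ~ ideal_gen [set s`_j | j in [set j | (j < size s)%N /\ j <> i]] s`_i) /\
  (forall i j, (i <= j < size s)%N ->
     colon_elt (ideal_gen [set` take i s]) (s`_i * s`_j) =
     colon_elt (ideal_gen [set` take i s]) s`_j).

Definition rees m I : set {poly R} :=
  [set f : {poly R} | forall k, ideal_mul I (ideal_exp m k) f`_k].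

Definition rees_ge1 m I : set {poly R} :=
  [set f : {poly R} | rees m I f /\ f`_0 = 0].

Definition poly_colon (N : set {poly R}) m : set {poly R} :=
  [set f : {poly R} | forall a, m a -> N (a *: f)].

(* Graded pieces are indexed by int, so that the shift N(1) also has its
   degree -1 piece N_0. *)
Definition component (N : set {poly R}) (j : int) : set R :=
  if j is Posz k then [set a | N (a *: 'X^k)] else [set 0].

Definition rees_colon_eq m I : Prop :=
  forall j : int,
    component (rees m I) j = component (poly_colon (rees_ge1 m I) m) (j + 1).

End Ideals.

Definition noetherian (R : comNzRingType) : Prop :=
  forall I : set R, is_ideal I -> exists s : seq R, I = ideal_gen [set` s].

(* For a local ring, the localization at its only maximal ideal is the ring
   itself, so this says that it is a regular local ring. *)
Definition regular (R : comNzRingType) : Prop :=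
  forall P : set R, maximal_ideal P -> regular_at P.

Section Graded.
Context {K : fieldType} {R : comNzRingType}.
Variables (iota : {rmorphism K -> R}) (G : nat -> set R).

Definition is_subalgebra (A : set R) : Prop :=
  [/\ forall k, A (iota k), forall a b, A a -> A b -> A (a + b)
    & forall a b, A a -> A b -> A (a * b)].

Definition homogeneous_ideal (I : set R) : Prop :=
  is_ideal I /\ I = ideal_gen (I `&` \bigcup_i G i).

(* R is the internal direct sum of the K-subspaces G i, with G 0 = K, and is
   generated as a K-algebra by G 1. *)
Definition standard_graded : Prop :=
  [/\ forall i, [/\ G i 0, forall a b, G i a -> G i b -> G i (a + b)
                  & forall k a, G i a -> G i (iota k * a)],
      forall a, exists n (c : nat -> R),
        (forall i, G i (c i)) /\ a = \sum_(i < n) c i,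
      forall n (c : nat -> R), (forall i, G i (c i)) ->
        \sum_(i < n) c i = 0 -> forall i, (i < n)%N -> c i = 0,
      forall i j a b, G i a -> G j b -> G (i + j)%N (a * b)
    & G 0%N = range iota /\ smallest is_subalgebra (G 1%N) = setT].

End Graded.

Definition unique_maximal (R : comNzRingType) (adm : set (set R)) (m : set R) :=
  [/\ adm m, maximal_ideal m
    & forall n, adm n -> maximal_ideal n -> n = m].

Inductive setting (R : comNzRingType) (m : set R) : set (set R) -> Prop :=
| LocalRing of noetherian R
    & unique_maximal is_ideal m
    & infinite_set (residue_classes m) :
    setting m is_ideal
| StandardGraded (K : fieldType) (iota : {rmorphism K -> R}) (G : nat -> set R)
    of noetherian R
    & standard_graded iota G
    & unique_maximal (homogeneous_ideal G) m
    & infinite_set [set: K] :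
    setting m (homogeneous_ideal G).

(* Main.v *)
(* Everything is equivalent to the fibre cone, the sum of the m^d / m^(d+1), being
   a polynomial ring on the classes of some generators s of m ([form_free]): a
   homogeneous form with a zero at s has all its coefficients in m.

   If it is not, K being infinite there is a K-point c at which a nonzero form
   vanishing at s does not vanish, and the elements c_j s_i - c_i s_j generate a
   reduction of m by one generator less.  That is excluded when m is a minimal
   reduction of itself, and, by Krull's height theorem, when m is locally
   generated by as many elements as its height.  Weak m-fullness of all the
   I m^k turns I m^r = m^(r+1) into I = m by taking colons with m, so (e) and
   (f) make m a minimal reduction of itself.  An ideal generated by a d-sequence
   is of linear type, which yields [form_free] from (b).

   Conversely [form_free] makes s a regular sequence, gives m^(d+1) : s_0 = m^d,
   and leaves m as its only reduction.  In the local case the ideals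
   (s_0, ..., s_(i-1)) form a chain of primes of length |s|; in the graded case R
   is a polynomial ring, which is regular at all its primes by adding the
   variables one by one. *)

Require Import Defs.
From HB Require Import structures.
From mathcomp Require Import all_boot all_order all_algebra.
From mathcomp Require Import boolp classical_sets functions cardinality.
From mathcomp Require Import mpoly ring.

Set Implicit Arguments.
Unset Strict Implicit.
Unset Printing Implicit Defensive.

Import GRing.Theory.
Local Open Scope classical_set_scope.
Local Open Scope ring_scope.

(** The obstacle is to run one argument in two settings: a graded ring is not local, and a local
    ring has no linear forms. All commutative algebra is therefore done at a prime [P] of a
    Noetherian ring, with [saturation P J], the contraction of the extension of [J] to the
    localization, in place of localized ideals. The record [frame] then extracts what both settings
    share. Its key field [frame_sat] says that admissible ideals are already saturated at [m]:
    elements outside [m] are units in the local case, and have an invertible constant term in the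
    graded case, which suffices for homogeneous ideals. So Nakayama and Krull's intersection theorem
    give plain inclusions into admissible ideals. The price is that the ideals built along the way
    must be admissible; this is why generators are taken in [V] and the coefficients of their
    combinations in [C]. The fibre cone is not formed either: forms over [R] and their coefficients
    modulo [m] replace it. *)

Section Ideals.
Context {R : comNzRingType}.
Implicit Types (I J L P Q m : set R) (A : set R) (s : seq R) (a b x : R).

Lemma ideal0 {I} : is_ideal I -> I 0. Proof. by case. Qed.

Lemma idealD {I a b} : is_ideal I -> I a -> I b -> I (a + b).
Proof. by case=> _ + _; apply. Qed.

Lemma idealMl {I a b} : is_ideal I -> I b -> I (a * b).
Proof. by case=> _ _; apply. Qed.

Lemma idealMr {I a b} : is_ideal I -> I a -> I (a * b).
Proof. by rewrite mulrC => hI; apply: idealMl. Qed.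

Lemma idealN {I a} : is_ideal I -> I a -> I (- a).
Proof. by move=> hI Ia; rewrite -mulN1r; apply: idealMl. Qed.

Lemma idealB {I a b} : is_ideal I -> I a -> I b -> I (a - b).
Proof. by move=> hI Ia Ib; apply: idealD => //; apply: idealN. Qed.

Lemma idealDr {I a b} : is_ideal I -> I b -> I (a + b) -> I a.
Proof. by move=> hI Ib Iab; rewrite -(addrK b a); apply: idealB. Qed.

Lemma ideal_sum {I} {T : Type} {r : seq T} {p : pred T} {F : T -> R} :
  is_ideal I -> (forall i, p i -> I (F i)) -> I (\sum_(i <- r | p i) F i).
Proof.
move=> hI hF; elim/big_ind: _ => //; first exact: ideal0.
by move=> a b; apply: idealD.
Qed.

Lemma ideal_1 I : is_ideal I -> I 1 -> I = setT.
Proof.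
by move=> hI I1; apply/seteqP; split=> // a _; rewrite -(mulr1 a); apply: idealMl.
Qed.

Lemma idealT : is_ideal (@setT R). Proof. by []. Qed.

Lemma ideal_zero : is_ideal [set (0 : R)].
Proof.
by split=> // [a b -> ->|r a ->]; rewrite /= ?addr0 ?mulr0.
Qed.

Lemma ideal_genP A : is_ideal (ideal_gen A).
Proof.
split=> [J [hJ _]|a b Ja Jb J [hJ AJ]|r a Ja J [hJ AJ]].
- exact: ideal0.
- by apply: idealD => //; [apply: Ja | apply: Jb].
- by apply: idealMl => //; apply: Ja.
Qed.
Hint Resolve ideal_genP : core.

Lemma sub_gen A : A `<=` ideal_gen A.
Proof. exact: sub_gen_smallest. Qed.

Lemma gen_sub A I : is_ideal I -> A `<=` I -> ideal_gen A `<=` I.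
Proof. exact: smallest_sub. Qed.

Lemma gen_mono A B : A `<=` B -> ideal_gen A `<=` ideal_gen B.
Proof. by move=> AB; apply: gen_sub => //; apply: subset_trans AB _; apply: sub_gen. Qed.

Lemma ideal_mulP I J : is_ideal (ideal_mul I J).
Proof. exact: ideal_genP. Qed.
Hint Resolve ideal_mulP : core.

Lemma mem_mul I J a b : I a -> J b -> ideal_mul I J (a * b).
Proof. by move=> Ia Jb; apply: sub_gen; exists a => //; exists b. Qed.

Lemma mul_sub I J L : is_ideal L ->
  (forall a b, I a -> J b -> L (a * b)) -> ideal_mul I J `<=` L.
Proof. by move=> hL h; apply: gen_sub => // _ [a Ia [b Jb <-]]; apply: h. Qed.

Lemma mul_mono I I' J J' :
  I `<=` I' -> J `<=` J' -> ideal_mul I J `<=` ideal_mul I' J'.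
Proof.
move=> hI hJ; apply: mul_sub => // a b Ia Jb.
by apply: mem_mul; [apply: hI | apply: hJ].
Qed.

Lemma ideal_mulC I J : ideal_mul I J = ideal_mul J I.
Proof.
by apply/seteqP; split; apply: mul_sub => // a b Ia Jb; rewrite mulrC; apply: mem_mul.
Qed.

Lemma ideal_mulr1 I : is_ideal I -> ideal_mul I setT = I.
Proof.
move=> hI; apply/seteqP; split; first by apply: mul_sub => // a b Ia _; apply: idealMr.
by move=> a Ia; rewrite -(mulr1 a); apply: mem_mul.
Qed.

Lemma mul_subl I J : is_ideal I -> ideal_mul I J `<=` I.
Proof. by move=> hI; apply: mul_sub => // a b Ia _; apply: idealMr. Qed.

Lemma mul_subr I J : is_ideal J -> ideal_mul I J `<=` J.
Proof. by move=> hI; apply: mul_sub => // a b _ Jb; apply: idealMl. Qed.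

Lemma ideal_colon_elt I x : is_ideal I -> is_ideal (colon_elt I x).
Proof.
move=> hI; split=> [|a b|r a]; rewrite /colon_elt /=.
- by rewrite mul0r; apply: ideal0.
- by rewrite mulrDl; apply: idealD.
- by rewrite -mulrA; apply: idealMl.
Qed.

Lemma mul_mulr I J L a b :
  is_ideal L -> ideal_mul I J a -> L b -> ideal_mul I (ideal_mul J L) (a * b).
Proof.
move=> hL Ia Lb.
have hK : is_ideal (colon_elt (ideal_mul I (ideal_mul J L)) b) by exact: ideal_colon_elt.
apply: (mul_sub hK _ Ia) => c d Ic Jd; rewrite /colon_elt /= -mulrA.
by apply: mem_mul => //; apply: mem_mul.
Qed.

Lemma mul_mull I J L a b :
  ideal_mul J L b -> I a -> ideal_mul (ideal_mul I J) L (a * b).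
Proof.
move=> JLb Ia.
have hK : is_ideal (colon_elt (ideal_mul (ideal_mul I J) L) a) by exact: ideal_colon_elt.
rewrite mulrC; apply: (mul_sub hK _ JLb) => c d Jc Ld.
rewrite /colon_elt /= mulrC mulrA.
by apply: mem_mul => //; apply: mem_mul.
Qed.

Lemma ideal_mulA I J L : is_ideal L ->
  ideal_mul I (ideal_mul J L) = ideal_mul (ideal_mul I J) L.
Proof.
move=> hL; apply/seteqP; split; apply: mul_sub => // a b ha hb; first exact: mul_mull.
exact: mul_mulr.
Qed.

Lemma ideal_expP I n : is_ideal (ideal_exp I n).
Proof. by case: n => //=. Qed.
Hint Resolve ideal_expP : core.

Lemma ideal_exp1 I : is_ideal I -> ideal_exp I 1 = I.
Proof. exact: ideal_mulr1. Qed.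

Lemma ideal_expS I n : ideal_exp I n.+1 = ideal_mul I (ideal_exp I n).
Proof. by []. Qed.

Lemma ideal_expD I i j :
  ideal_exp I (i + j) = ideal_mul (ideal_exp I i) (ideal_exp I j).
Proof.
elim: i => [|i ih]; first by rewrite ideal_mulC ideal_mulr1.
by rewrite addSn !ideal_expS ih ideal_mulA.
Qed.

Lemma mem_expD I i j a b :
  ideal_exp I i a -> ideal_exp I j b -> ideal_exp I (i + j) (a * b).
Proof. by rewrite ideal_expD; apply: mem_mul. Qed.

Lemma exp_le I i j : (i <= j)%N -> ideal_exp I j `<=` ideal_exp I i.
Proof. by move/subnK <-; rewrite ideal_expD; apply: mul_subr. Qed.

Lemma mem_expX I i a : I a -> ideal_exp I i (a ^+ i).
Proof. by move=> Ia; elim: i => // i ih; rewrite exprS; apply: mem_mul. Qed.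

Lemma ideal_expM I i n : ideal_exp (ideal_exp I i) n = ideal_exp I (i * n).
Proof.
by elim: n => [|n ih]; rewrite ?muln0 // mulnS ideal_expD ideal_expS ih.
Qed.

Definition ideal_add I J : set R := [set a + b | a in I & b in J].

Lemma ideal_addP I J : is_ideal I -> is_ideal J -> is_ideal (ideal_add I J).
Proof.
move=> hI hJ; split.
- by exists 0; [exact: ideal0|exists 0; [exact: ideal0|rewrite addr0]].
- move=> _ _ [a Ia [b Jb <-]] [c Ic [d Jd <-]].
  exists (a + c); first exact: idealD.
  by exists (b + d); [exact: idealD|ring].
- move=> r _ [a Ia [b Jb <-]]; exists (r * a); first exact: idealMl.
  by exists (r * b); [exact: idealMl|ring].
Qed.

Lemma add_subl I J : is_ideal J -> I `<=` ideal_add I J.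
Proof. by move=> hJ a Ia; exists a => //; exists 0; [exact: ideal0|rewrite addr0]. Qed.

Lemma add_subr I J : is_ideal I -> J `<=` ideal_add I J.
Proof. by move=> hI a Ja; exists 0; [exact: ideal0|exists a => //; rewrite add0r]. Qed.

Lemma add_sub I J L : is_ideal L -> I `<=` L -> J `<=` L -> ideal_add I J `<=` L.
Proof. by move=> hL IL JL _ [a Ia [b Jb <-]]; apply: idealD => //; [apply: IL|apply: JL]. Qed.

Lemma mem_add I J a b : I a -> J b -> ideal_add I J (a + b).
Proof. by move=> Ia Jb; exists a => //; exists b. Qed.

Definition multiples x : set R := [set r * x | r in setT].

Lemma ideal_multiples x : is_ideal (multiples x).
Proof.
split=> [|_ _ [a _ <-] [b _ <-]|r _ [a _ <-]].
- by exists 0 => //; rewrite mul0r.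
- by exists (a + b) => //; rewrite mulrDl.
- by exists (r * a) => //; rewrite mulrA.
Qed.

Lemma mem_multiples x : multiples x x.
Proof. by exists 1 => //; rewrite mul1r. Qed.

Lemma multiples_sub I x : is_ideal I -> I x -> multiples x `<=` I.
Proof. by move=> hI Ix _ [r _ <-]; apply: idealMl. Qed.

Lemma gen_seqP s a : ideal_gen [set` s] a <->
  exists c : 'I_(size s) -> R, a = \sum_i c i * s`_i.
Proof.
split; last first.
  case=> c ->; apply: ideal_sum => // i _; apply: (idealMl (ideal_genP _)).
  by apply: sub_gen; exact: mem_nth.
move=> ha; apply: (ha [set a | exists c : 'I_(size s) -> R, a = \sum_i c i * s`_i]).
split; first split.
- by exists (fun=> 0); rewrite big1 // => i _; rewrite mul0r.
- move=> _ _ [c ->] [d ->]; exists (fun i => c i + d i).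
  by rewrite -big_split; apply: eq_bigr => i _; rewrite mulrDl.
- move=> r _ [c ->]; exists (fun i => r * c i).
  by rewrite mulr_sumr; apply: eq_bigr => i _; rewrite mulrA.
move=> b /= bs; have ib : (index b s < size s)%N by rewrite index_mem.
exists (fun i => (i == Ordinal ib)%:R); rewrite (bigD1 (Ordinal ib)) //= eqxx mul1r.
rewrite nth_index // big1 ?addr0 // => i /negbTE->.
by rewrite mul0r.
Qed.

Lemma gen_seq_sub s I : is_ideal I -> (forall i, (i < size s)%N -> I s`_i) ->
  ideal_gen [set` s] `<=` I.
Proof.
by move=> hI h; apply: gen_sub => // a /= /(nthP 0) [i hi <-]; apply: h.
Qed.

Lemma mem_gen_nth s i : (i < size s)%N -> ideal_gen [set` s] s`_i.
Proof. by move=> hi; apply: sub_gen; exact: mem_nth. Qed.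

Lemma gen_cons x s :
  ideal_gen [set` x :: s] = ideal_add (ideal_gen [set` s]) (multiples x).
Proof.
apply/seteqP; split.
  apply: gen_sub; first by apply: ideal_addP => //; apply: ideal_multiples.
  move=> a /=; rewrite inE => /orP[/eqP->|as_].
    by apply: add_subr => //; apply: mem_multiples.
  by apply: add_subl; [apply: ideal_multiples|apply: sub_gen].
apply: add_sub => //; first by apply: gen_mono => a /=; rewrite inE => ->; rewrite orbT.
by apply: multiples_sub => //; apply: sub_gen; rewrite /= inE eqxx.
Qed.

Lemma gen_perm s (t : seq R) : s =i t -> ideal_gen [set` s] = ideal_gen [set` t].
Proof. by move=> st; congr ideal_gen; apply/seteqP; split=> a /=; rewrite st. Qed.

Lemma gen_take_S s i : (i < size s)%N ->
  ideal_gen [set` take i.+1 s] = ideal_add (ideal_gen [set` take i s]) (multiples s`_i).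
Proof.
move=> hi; rewrite -gen_cons; apply: gen_perm => a.
by rewrite (take_nth 0) // mem_rcons.
Qed.

Lemma prime_ideal_ideal P : prime_ideal P -> is_ideal P. Proof. by case. Qed.

Lemma primeM P a b : prime_ideal P -> ~ P a -> ~ P b -> ~ P (a * b).
Proof. by case=> _ _ h Pa Pb /h[]. Qed.

Lemma primeX P a n : prime_ideal P -> P (a ^+ n) -> P a.
Proof.
by case=> _ P1 h; elim: n => [/P1|n ih] //; rewrite exprS => /h[].
Qed.

Lemma prime_prod P (T : Type) (r : seq T) (F : T -> R) : prime_ideal P ->
  (forall i, ~ P (F i)) -> ~ P (\prod_(i <- r) F i).
Proof.
move=> hP hF; elim/big_ind: _ => //; first by case: hP.
by move=> a b; apply: primeM.
Qed.

Lemma maximal_add m a : maximal_ideal m -> ~ m a -> exists r b, m b /\ 1 = r * a + b.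
Proof.
case=> hm m1 hmax ma.
have hJ : is_ideal (ideal_add m (multiples a)).
  by apply: ideal_addP => //; apply: ideal_multiples.
case: (pselect (ideal_add m (multiples a) 1)) => [[b mb [_ [r _ <-] e]]|J1].
  by exists r, b; rewrite addrC e.
case: ma; rewrite -(hmax _ hJ _ J1).
  by apply: add_subr => //; apply: mem_multiples.
by apply: add_subl; apply: ideal_multiples.
Qed.

Lemma maximal_prime m : maximal_ideal m -> prime_ideal m.
Proof.
move=> mm; case: (mm) => hm m1 _; split=> // a b mab.
case: (pselect (m a)) => ma; [by left|right].
have [r [c [mc e]]] := maximal_add mm ma.
rewrite -(mulr1 b) e mulrDr; apply: idealD => //; last exact: idealMl.
by rewrite mulrCA (mulrC b); apply: idealMl.
Qed.

End Ideals.
#[export] Hint Resolve ideal_genP ideal_mulP ideal_expP ideal_multiples idealT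
  ideal_zero : core.

(** * Noetherian rings: Krull's theorems, with saturations in place of localizations *)

Section Noetherian.
Context {R : comNzRingType}.
Implicit Types (I J L P Q m B N : set R) (s : seq R) (a b x : R).

Definition saturation P J : set R := [set a | exists2 u, ~ P u & J (u * a)].

Lemma saturationP P J : prime_ideal P -> is_ideal J -> is_ideal (saturation P J).
Proof.
move=> hP hJ; split.
- by exists 1; [case: hP|rewrite mulr0; exact: ideal0].
- move=> a b [u Pu Ju] [v Pv Jv]; exists (u * v); first exact: primeM.
  have -> : u * v * (a + b) = v * (u * a) + u * (v * b) by ring.
  by apply: idealD => //; apply: idealMl.
- move=> r a [u Pu Ju]; exists u => //.
  by rewrite mulrCA; apply: idealMl.
Qed.

Lemma sub_saturation P J : prime_ideal P -> J `<=` saturation P J.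
Proof. by move=> hP a Ja; exists 1; rewrite ?mul1r //; case: hP. Qed.

Lemma saturation_mono P J J' : J `<=` J' -> saturation P J `<=` saturation P J'.
Proof. by move=> JJ' a [u Pu Ju]; exists u => //; apply: JJ'. Qed.

Definition saturated P J := forall u a, ~ P u -> J (u * a) -> J a.

Lemma saturation_saturated P J : prime_ideal P -> saturated P (saturation P J).
Proof.
move=> hP u a Pu [v Pv Jv]; exists (v * u); first exact: primeM.
by rewrite -mulrA.
Qed.

Lemma saturation_sub P J : saturated P J -> saturation P J `<=` J.
Proof. by move=> h a [u Pu /h]; apply. Qed.

(** [P] is a minimal prime of [I], in the form that the radical of [I] becomes [P] after localizing
    at [P]; [minimal_over_sub] and [minimal_over_or] link this to inclusions of primes. *)
Definition minimal_over P I :=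
  I `<=` P /\ forall a, P a -> exists u n, ~ P u /\ I (u * a ^+ n).

Lemma minimal_over_sub P Q I :
  prime_ideal Q -> minimal_over P I -> I `<=` Q -> Q `<=` P -> P `<=` Q.
Proof.
move=> hQ [_ h] IQ QP a /h[u [n [Pu /IQ Qua]]].
case: (hQ) => _ _ /(_ _ _ Qua)[/QP//|]; exact: primeX.
Qed.

Hypothesis hR : noetherian R.

Lemma noetherian_chain (f : nat -> set R) : (forall n, is_ideal (f n)) ->
  (forall n, f n `<=` f n.+1) -> exists n, forall k, (n <= k)%N -> f k = f n.
Proof.
move=> hf fS.
have fm i j : (i <= j)%N -> f i `<=` f j.
  by move/subnK <-; elim: (j - i)%N => // k ih; apply: subset_trans ih _; apply: fS.
have hU : is_ideal (\bigcup_n f n).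
  split=> [|a b [i _ fa] [j _ fb]|r a [i _ fa]].
  - by exists 0%N => //; exact: ideal0.
  - exists (maxn i j) => //; apply: idealD => //.
      by apply: fm fa; rewrite leq_maxl.
    by apply: fm fb; rewrite leq_maxr.
  - by exists i => //; apply: idealMl.
have [s es] := hR hU.
have [n hn] : exists n, forall a, a \in s -> f n a.
  have : forall a, a \in s -> exists n, f n a.
    move=> a sa; have : (\bigcup_n f n) a by rewrite es; apply: sub_gen.
    by case=> n _; exists n.
  elim: (s) => [|b t ih] h; first by exists 0%N.
  have [n hn] : exists n, forall a, a \in t -> f n a.
    by apply: ih => a ta; apply: h; rewrite inE ta orbT.
  have [k hk] := h b (mem_head _ _).
  exists (maxn n k) => a; rewrite inE => /orP[/eqP->|/hn].
    by apply: fm hk; rewrite leq_maxr.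
  by apply: fm; rewrite leq_maxl.
exists n => k nk; apply/seteqP; split; last exact: fm.
have : f k `<=` \bigcup_n f n by move=> a fa; exists k.
by rewrite es => /subset_trans; apply; apply: gen_sub.
Qed.

(** Source of the Noetherian inductions below: without a maximal member above [I0], choice builds a
    strictly ascending chain in [F]. *)
Lemma noetherian_max (F : set (set R)) I0 : (forall I, F I -> is_ideal I) -> F I0 ->
  exists I, [/\ F I, I0 `<=` I & forall J, F J -> I `<=` J -> J = I].
Proof.
move=> hF F0; apply: contrapT => hno.
pose T := {I : set R | F I /\ I0 `<=` I}.
have next (X : T) : exists Y : T, sval X `<=` sval Y /\ sval Y <> sval X.
  case: X => I [FI I0I]; apply: contrapT => hX; apply: hno; exists I; split=> // J FJ IJ.
  apply: contrapT => JI; apply: hX.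
  by exists (exist _ J (conj FJ (subset_trans I0I IJ))).
have [g hg] := choice next.
pose f n := sval (iter n g (exist _ I0 (conj F0 (@subset_refl _ I0)))).
have [n hn] : exists n, forall k, (n <= k)%N -> f k = f n.
  apply: noetherian_chain => n; first by apply: hF; rewrite /f; case: (iter n g _) => ? [].
  by have [] := hg (iter n g (exist _ I0 (conj F0 (@subset_refl _ I0)))).
have := hn n.+1 (leqnSn n).
by have [] := hg (iter n g (exist _ I0 (conj F0 (@subset_refl _ I0)))).
Qed.

(** An ideal [Q] maximal among those above [I] that avoid [S] is prime: if [a] and [b] lie outside,
    both [Q + (a)] and [Q + (b)] meet [S], and the product of the two elements found lies in [Q] as
    soon as [a * b] does. *)
Lemma prime_avoiding (S : set R) I : is_ideal I -> S 1 ->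
  (forall a b, S a -> S b -> S (a * b)) -> (forall a, S a -> ~ I a) ->
  exists Q, [/\ prime_ideal Q, I `<=` Q & forall a, S a -> ~ Q a].
Proof.
move=> hI S1 SM SI.
have [|Q [[hQ SQ] IQ Qmax]] := @noetherian_max
  [set J | is_ideal J /\ forall a, S a -> ~ J a] I _ (conj hI SI); first by move=> ? [].
exists Q; split=> //; split=> //; first exact: SQ.
have meet a : ~ Q a -> exists2 c, S c & exists q r, Q q /\ c = q + r * a.
  move=> Qa; apply: contrapT => hno; apply: Qa.
  have hJ : is_ideal (ideal_add Q (multiples a)) by exact: ideal_addP.
  rewrite -(Qmax (ideal_add Q (multiples a))).
  - by apply: add_subr => //; apply: mem_multiples.
  - split=> // c Sc [q Qq [_ [r _ <-] e]]; apply: hno.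
    by exists c => //; exists q, r.
  - exact: add_subl.
move=> a b Qab; case: (pselect (Q a)) => Qa; [by left|right].
apply: contrapT => Qb.
have [c Sc [q [r [Qq ec]]]] := meet a Qa.
have [d Sd [q' [r' [Qq' ed]]]] := meet b Qb.
apply: (SQ (c * d)); first exact: SM.
have -> : c * d = q * d + r * a * q' + (r * r') * (a * b) by rewrite ec ed; ring.
apply: idealD => //; last exact: idealMl.
by apply: idealD => //; [exact: idealMr|exact: idealMl].
Qed.

Lemma minimal_over_or P I : prime_ideal P -> is_ideal I -> I `<=` P ->
  minimal_over P I \/ exists Q, [/\ prime_ideal Q, I `<=` Q & Q `<` P].
Proof.
move=> hP hI IP; case: (pselect (minimal_over P I)) => [|hno]; [by left|right].
have [a [Pa ha]] : exists a, P a /\ forall u n, ~ P u -> ~ I (u * a ^+ n).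
  apply: contrapT => hno'; apply: hno; split=> // a Pa; apply: contrapT => h.
  by apply: hno'; exists a; split=> // u n Pu Iu; apply: h; exists u, n.
(* The products [u * a ^+ n] with [u] outside [P] avoid [I]; a prime avoiding them lies in [P] (take
   [n = 0]) and misses [a]. *)
have [Q [hQ IQ SQ]] : exists Q, [/\ prime_ideal Q, I `<=` Q
    & forall b, [set b | exists u n, ~ P u /\ b = u * a ^+ n] b -> ~ Q b].
  apply: prime_avoiding => // [|b c|b].
  - by exists 1, 0%N; rewrite mulr1; split=> //; case: hP.
  - move=> [u [n [Pu ->]]] [v [k [Pv ->]]]; exists (u * v), (n + k)%N.
    by split; [exact: primeM|rewrite exprD; ring].
  - by move=> [u [n [Pu ->]]]; apply: ha.
have P1 : ~ P 1 by case: hP.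
exists Q; split=> //; split.
  move=> u Qu; apply: contrapT => Pu; apply: (SQ u) Qu.
  by exists u, 0%N; rewrite mulr1.
move=> /(_ a Pa); apply: SQ; exists 1, 1%N.
by rewrite mul1r.
Qed.

(** Existence of an associated prime: take [I : z] maximal with [z] outside [I]. If [b * z] is
    outside [I] too, then [I : b z] contains [I : z], hence equals it. *)
Lemma ideal_colon_prime I : is_ideal I -> ~ I 1 ->
  exists2 z, ~ I z & prime_ideal (colon_elt I z).
Proof.
move=> hI I1.
have [||_ [[z Iz ->] _ zmax]] := @noetherian_max
    [set J | exists2 z, ~ I z & J = colon_elt I z] (colon_elt I 1).
- by move=> _ [z _ ->]; exact: ideal_colon_elt.
- by exists 1.
exists z => //; split; [exact: ideal_colon_elt|by rewrite /colon_elt /= mul1r|].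
move=> a b abz; case: (pselect (colon_elt I z b)) => bz; [by right|left].
rewrite -(zmax (colon_elt I (b * z))).
- by rewrite /colon_elt /= mulrA.
- by exists (b * z).
- by move=> c; rewrite /colon_elt /= mulrCA; apply: idealMl.
Qed.

(* Artinianity of the localization of R/I at a minimal prime P of I: an ideal I
   maximal among counterexamples is saturated and P is an associated prime
   I : z of it, so a chain above I is controlled by its sum with (z). *)
Lemma minimal_over_dcc P I (J : nat -> set R) :
  prime_ideal P -> is_ideal I -> minimal_over P I ->
  (forall n, [/\ is_ideal (J n), saturated P (J n), I `<=` J n & J n.+1 `<=` J n]) ->
  exists n, forall k, (n <= k)%N -> J k.+1 = J k.
Proof.
move=> hP hI [_ Imin].
pose dcc I' := forall J : nat -> set R,
  (forall n, [/\ is_ideal (J n), saturated P (J n), I' `<=` J n & J n.+1 `<=` J n]) ->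
  exists n, forall k, (n <= k)%N -> J k.+1 = J k.
suff : dcc I by apply.
apply: contrapT => hdcc.
have [|I' [[hI' Idcc] II' Imax]] := @noetherian_max
  [set I' | is_ideal I' /\ ~ dcc I'] I _ (conj hI hdcc); first by move=> ? [].
have dcc_above I'' : is_ideal I'' -> I' `<=` I'' -> I'' <> I' -> dcc I''.
  by move=> h h' ne; apply: contrapT => hn; apply: ne; apply: Imax.
(* A chain of saturated ideals above [I'] also lies above the saturation of [I'], which is thus a
   counterexample as well; maximality of [I'] applies. *)
have sat : saturated P I'.
  rewrite -(Imax (saturation P I')).
  - exact: saturation_saturated.
  - split; first exact: saturationP.
    move=> h; apply: Idcc => K hK; apply: h => n; have [K1 K2 K3 K4] := hK n.
    by split=> //; apply: subset_trans _ (saturation_sub K2); apply: saturation_mono.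
  - exact: sub_saturation.
case: (pselect (I' 1)) => [I1|I1].
  apply: Idcc => K hK; exists 0%N => k _.
  have KT n : K n = setT by have [? _ KI _] := hK n; apply: ideal_1 => //; apply: KI.
  by rewrite !KT.
have [z Iz hQ] := ideal_colon_prime hI' I1.
have colP a : P a -> I' (a * z).
  move=> Pa; have [u [n [Pu Iu]]] := Imin a Pa.
  apply: (primeX (n := n) hQ); case: (hQ) => _ _ /(_ u (a ^+ n)) [|uz|//].
    by rewrite /colon_elt /=; apply: idealMr => //; apply: II'.
  by case: Iz; apply: sat uz.
have hIz : is_ideal (ideal_add I' (multiples z)) by exact: ideal_addP.
have /(_ _) dccz : dcc (ideal_add I' (multiples z)).
  apply: dcc_above => //; first exact: add_subl.
  by move=> e; apply: Iz; rewrite -e; apply: add_subr => //; apply: mem_multiples.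
apply: Idcc => K hK.
have hKi n : is_ideal (K n) by case: (hK n).
have Kle i j : (i <= j)%N -> K j `<=` K i.
  move/subnK <-; elim: (j - i)%N => // k ih; apply: subset_trans _ ih.
  by case: (hK (k + i)%N).
case: (pselect (forall n, K n z)) => [Kz|].
  apply: dccz => n; have [? ? ? ?] := hK n; split=> //.
  by apply: add_sub => //; apply: multiples_sub.
move=> /existsNP[n1 Kz].
have [|n2 hn2] := dccz (fun n => saturation P (ideal_add (K n) (multiples z))).
  move=> n; have [K1 K2 K3 K4] := hK n.
  have hKz : is_ideal (ideal_add (K n) (multiples z)) by exact: ideal_addP.
  split; [exact: saturationP|exact: saturation_saturated| |].
    apply: subset_trans _ (sub_saturation hP); apply: add_sub => //.
      by move=> a /K3; exact: add_subl.
    exact: add_subr.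
  apply: saturation_mono; apply: add_sub => //; last exact: add_subr.
  by move=> a /K4; exact: add_subl.
exists (maxn n1 n2) => k; rewrite geq_max => /andP[k1 k2].
have [K1 K2 K3 K4] := hK k; have [K1' K2' K3' K4'] := hK k.+1.
apply/seteqP; split=> // a Ka.
have : saturation P (ideal_add (K k) (multiples z)) a.
  by apply: sub_saturation => //; apply: add_subl.
rewrite -hn2 // => -[u Pu [b Kb [_ [c _ <-] e]]].
have Kcz : K k (c * z).
  have -> : c * z = u * a - b by rewrite -e; ring.
  by apply: idealB => //; [exact: idealMl|exact: K4].
(* Otherwise saturation would put [z] into [K k], hence into [K n1]. With [c] in [P], the term
   [c * z] already lies in [I'], so in every member of the chain. *)
have Pc : P c by apply: contrapT => Pc; apply: Kz; apply: (Kle _ k) => //; apply: K2 Kcz.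
apply: (K2' u) => //; rewrite -e; apply: idealD => //.
by apply: K3'; apply: colP.
Qed.

(** By Noetherian induction instead of determinants. Let [C] be maximal among the saturated ideals
    above [B] that do not contain [N]. If [p * w] is outside [C], then adding it captures [w], so
    [(u - r * p) * w] lies in [C] with [u - r * p] outside [P], and [w] was in [C] already. Hence
    [P N] lies in [C], and so does [N]. *)
Lemma local_nakayama P B N : prime_ideal P -> is_ideal B -> is_ideal N ->
  N `<=` saturation P (ideal_add B (ideal_mul P N)) -> N `<=` saturation P B.
Proof.
move=> hP hB hN NB; apply: contrapT => hno.
have hPi := prime_ideal_ideal hP.
have [||C [[hC Csat NC] BC Cmax]] := @noetherian_max
  [set C | [/\ is_ideal C, saturated P C & ~ N `<=` C]] (saturation P B).
- by move=> ? [].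
- by split=> //; [exact: saturationP|exact: saturation_saturated].
suff PNC : ideal_mul P N `<=` C.
  apply: NC; apply: subset_trans NB _; apply: subset_trans _ (saturation_sub Csat).
  apply: saturation_mono; apply: add_sub => //.
  by apply: subset_trans _ BC; exact: sub_saturation.
apply: mul_sub => // p w Pp Nw; apply: contrapT => Cpw.
have hCp : is_ideal (ideal_add C (multiples (p * w))) by exact: ideal_addP.
have [u Pu [c Cc [_ [r _ <-] e]]] : saturation P (ideal_add C (multiples (p * w))) w.
  apply: contrapT => hw; apply: Cpw.
  rewrite -(Cmax (saturation P (ideal_add C (multiples (p * w))))).
  - by apply: sub_saturation => //; apply: add_subr => //; exact: mem_multiples.
  - split; [exact: saturationP|exact: saturation_saturated|by move/(_ w Nw)].
  - by apply: subset_trans _ (sub_saturation hP); exact: add_subl.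
apply: Cpw; apply: idealMl => //; apply: (Csat (u - r * p)).
  move=> Pup; apply: Pu; rewrite -(subrK (r * p) u).
  by apply: idealD => //; exact: idealMl.
by have -> : (u - r * p) * w = c by apply: (addIr (r * (p * w))); rewrite e; ring.
Qed.

(* Krull's principal ideal theorem for the ring R/Q0, by symbolic powers of Q. *)
Lemma principal_ideal_theorem P Q Q0 x : prime_ideal P -> prime_ideal Q ->
  prime_ideal Q0 -> Q0 `<` Q -> Q `<` P ->
  ~ minimal_over P (ideal_add Q0 (multiples x)).
Proof.
move=> hP hQ hQ0 [Q0Q QQ0] [QP PQ] hmin.
have hPi := prime_ideal_ideal hP; have hQi := prime_ideal_ideal hQ.
have hQ0i := prime_ideal_ideal hQ0.
have hI : is_ideal (ideal_add Q0 (multiples x)) by exact: ideal_addP.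
have Qx : ~ Q x.
  move=> Qx; apply: PQ; apply: minimal_over_sub hmin _ _ => //.
  by apply: add_sub => //; apply: multiples_sub.
have Px : P x by apply: hmin.1; apply: add_subr => //; exact: mem_multiples.
have PQu u : ~ P u -> ~ Q u by move=> Pu /QP.
(* The preimage in [R] of the [n]-th symbolic power of [Q/Q0]. *)
pose sym n := saturation Q (ideal_add Q0 (ideal_exp Q n)).
have hQn n : is_ideal (ideal_add Q0 (ideal_exp Q n)) by exact: ideal_addP.
have hsym n : is_ideal (sym n) by exact: saturationP.
have symS n : sym n.+1 `<=` sym n.
  apply: saturation_mono; apply: add_sub => //; first exact: add_subl.
  by move=> a /(exp_le (leqnSn n)); exact: add_subr.
have hJ n : is_ideal (ideal_add (sym n) (multiples x)) by exact: ideal_addP.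
have Q0sym n : Q0 `<=` sym n.
  by apply: subset_trans _ (sub_saturation hQ); exact: add_subl.
have [|n hn] := @minimal_over_dcc P _
    (fun n => saturation P (ideal_add (sym n) (multiples x))) hP hI hmin.
  move=> n; split; [exact: saturationP|exact: saturation_saturated| |].
    apply: subset_trans _ (sub_saturation hP); apply: add_sub => //.
      by move=> a /(Q0sym n); exact: add_subl.
    exact: add_subr.
  apply: saturation_mono; apply: add_sub => //; last exact: add_subr.
  by move=> a /symS; exact: add_subl.
(* Stability modulo [x] gives [u * a = b + c * x] with [b] in [sym n.+1]. Then [c * x] is in
   [sym n], and so is [c], because [x] is outside [Q]; and [x] is in [P]. *)
have /local_nakayama : sym n `<=` saturation P (ideal_add (sym n.+1) (ideal_mul P (sym n))).
  move=> a sa.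
  have : saturation P (ideal_add (sym n) (multiples x)) a.
    by apply: (sub_saturation hP); exact: (add_subl (ideal_multiples x) sa).
  rewrite -hn // => -[u Pu [b sb [_ [c _ <-] e]]]; exists u => //.
  exists b => //; exists (c * x) => //; rewrite mulrC; apply: mem_mul => //.
  apply: (@saturation_saturated _ _ hQ x) => //.
  have -> : x * c = u * a - b by rewrite -e; ring.
  by apply: (idealB (hsym n)); [exact: idealMl|exact: symS].
move=> /(_ hP (hsym _) (hsym _)) symE.
(* Nakayama at [P] has identified two consecutive symbolic powers; Nakayama at [Q] now puts [Q^n]
   into [Q0] locally, against [Q0] being smaller than [Q]. *)
have /local_nakayama : ideal_exp Q n `<=`
    saturation Q (ideal_add Q0 (ideal_mul Q (ideal_exp Q n))).
  move=> a Qa; have [|u Pu su] := symE a.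
    by apply: sub_saturation => //; exact: add_subr.
  by apply: (saturation_saturated hQ) su; exact: PQu.
move=> /(_ hQ hQ0i (ideal_expP _ _)) QnQ0.
apply: QQ0 => a Qa; have [u Qu Q0u] := QnQ0 _ (mem_expX n Qa).
case: (hQ0) => _ _ /(_ _ _ Q0u)[/Q0Q//|]; exact: primeX.
Qed.

(* Krull's height theorem.  The next-to-last prime Q of a chain can be taken
   maximal below P; if x = s_j is outside Q, powers of the other generators are
   congruent modulo x to elements y of Q, and Q is minimal over (y). *)
Lemma height_theorem P s n : prime_ideal P -> minimal_over P (ideal_gen [set` s]) ->
  prime_chain P n -> (n <= size s)%N.
Proof.
move: {2}(size s) (erefl (size s)) => k ek; elim: k P s n ek => [|k ih] P s n ek hP hmin.
  case: n => // n [c [hc cS cn]].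
  have [cP] := cS n (ltnSn n); rewrite cn; case.
  apply: minimal_over_sub hmin _ _; [exact: hc| |by rewrite -cn].
  rewrite (size0nil ek); apply: gen_sub => //; apply: prime_ideal_ideal; exact: hc.
case: n => // n [c [hc cS cn]]; rewrite ek ltnS.
have hPi := prime_ideal_ideal hP.
have cnP : c n `<` P by rewrite -cn; exact: cS.
have [||Q [[hQ QP] cQ Qmax]] := @noetherian_max [set Q | prime_ideal Q /\ Q `<` P] (c n).
- by move=> ? [/prime_ideal_ideal].
- by split=> //; exact: hc.
have hQi := prime_ideal_ideal hQ.
have chainQ : prime_chain Q n.
  exists (fun i => if i == n then Q else c i); split=> [i|i lin|]; last by rewrite eqxx.
    by case: eqP => // _ /leqW; exact: hc.
  rewrite (ltn_eqF lin); case: eqP => [e|_]; last by apply: cS; exact: leqW.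
  have [ci nci] : c i `<` c n by rewrite -e; apply: cS; exact: leqW.
  by split=> [|h]; [exact: subset_trans ci cQ|apply: nci; exact: subset_trans cQ h].
have [x sx Qx] : exists2 x, x \in s & ~ Q x.
  apply: contrapT => hno; apply: QP.2; apply: minimal_over_sub hmin _ QP.1 => //.
  apply: gen_sub => // x /= sx; apply: contrapT => Qx; apply: hno; by exists x.
have Ps a : a \in s -> P a by move=> sa; apply: hmin.1; exact: sub_gen.
have hQx : is_ideal (ideal_add Q (multiples x)) by exact: ideal_addP.
have Qxmin : minimal_over P (ideal_add Q (multiples x)).
  case: (@minimal_over_or P (ideal_add Q (multiples x))) => //.
    by apply: add_sub => //; [exact: QP.1|apply: multiples_sub => //; exact: Ps].
  case=> Q' [hQ' QQ' Q'P]; case: Qx; rewrite -(Qmax Q') //.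
    by apply: QQ'; apply: add_subr => //; exact: mem_multiples.
  by apply: subset_trans _ QQ'; exact: add_subl.
have /choice[f hf] : forall b, exists y, b \in s ->
    Q y /\ exists u n r, ~ P u /\ u * b ^+ n = y + r * x.
  move=> b.
  case: (boolP (b \in s)) => [sb|_]; last by exists 0.
  have [u [j [Pu [y Qy [_ [r _ <-] e]]]]] := Qxmin.2 b (Ps b sb).
  by exists y => _; split=> //; exists u, j, r.
pose y := [seq f b | b <- rem x s].
have sy : size y = k by rewrite size_map size_rem // ek.
rewrite -sy; apply: (ih Q) => //.
have yQ : ideal_gen [set` y] `<=` Q.
  by apply: gen_sub => // _ /mapP[b /mem_rem/hf[Qb _] ->].
(* A prime [Q'] above [y] and strictly below [Q] contradicts the principal ideal theorem for [Q'],
   [Q], [P] and [x]: a prime between [Q' + (x)] and [P] contains some [u * b ^+ j], hence [b], for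
   each generator [b], so it is [P]. *)
case: (@minimal_over_or Q (ideal_gen [set` y])) => // -[Q' [hQ' yQ' Q'Q]].
have hQ'i := prime_ideal_ideal hQ'.
have hQ'x : is_ideal (ideal_add Q' (multiples x)) by exact: ideal_addP.
case: (@principal_ideal_theorem P Q Q' x) => //.
case: (@minimal_over_or P (ideal_add Q' (multiples x))) => //.
  apply: add_sub => //; last by apply: multiples_sub => //; exact: Ps.
  exact: subset_trans Q'Q.1 QP.1.
case=> Q2 [hQ2 Q'Q2 [Q2P PQ2]]; case: PQ2; apply: minimal_over_sub hmin _ _ => //.
have hQ2i := prime_ideal_ideal hQ2.
have Q2x : Q2 x by apply: Q'Q2; apply: add_subr => //; exact: mem_multiples.
apply: gen_sub => // b /= sb; case: (eqVneq b x) => [->//|bx].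
have [_ [u [j [r [Pu e]]]]] := hf b sb.
have : Q2 (u * b ^+ j).
  rewrite e; apply: idealD => //; last exact: idealMl.
  apply: Q'Q2; apply: add_subl => //; apply: yQ'; apply: sub_gen => /=.
  by apply: map_f; move: sb; rewrite (perm_mem (perm_to_rem sx)) inE (negbTE bx).
by case: (hQ2) => _ _ h /h[/Q2P//|]; exact: primeX.
Qed.

(** A maximal counterexample [C] above [B] is prime: if powers of [m] lie in [C + (a)] and in
    [C + (b)] with [a * b] in [C], their product lies in [C]. A prime containing powers of all
    elements of [m] contains [m]. *)
Lemma exp_sub_of_nilpotent m B : is_ideal m -> is_ideal B ->
  (forall a, m a -> exists n, B (a ^+ n)) -> exists n, ideal_exp m n `<=` B.
Proof.
move=> hm hB nilp; apply: contrapT => hno.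
have [|C [[hC Cno] BC Cmax]] := @noetherian_max
    [set C | is_ideal C /\ ~ exists n, ideal_exp m n `<=` C] B _ (conj hB hno).
  by move=> ? [].
have grow a : ~ C a -> exists n, ideal_exp m n `<=` ideal_add C (multiples a).
  have hCa : is_ideal (ideal_add C (multiples a)) by exact: ideal_addP.
  move=> Ca; apply: contrapT => ha; apply: Ca.
  rewrite -(Cmax (ideal_add C (multiples a))) //; last exact: add_subl.
  by apply: add_subr => //; exact: mem_multiples.
have hCp : prime_ideal C.
  split=> // [C1|a b Cab].
    by apply: Cno; exists 0%N; rewrite (ideal_1 hC C1).
  case: (pselect (C a)) => Ca; [by left|right].
  apply: contrapT => Cb; apply: Cno.
  have [i hi] := grow a Ca; have [j hj] := grow b Cb; exists (i + j)%N.
  rewrite ideal_expD; apply: mul_sub => // y z /hi[c Cc [_ [r _ <-] <-]].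
  move=> /hj[d Cd [_ [t _ <-] <-]].
  have -> : (c + r * a) * (d + t * b) = (d + t * b) * c + (r * a) * d + (r * t) * (a * b).
    by ring.
  by apply: idealD => //; [apply: idealD => //|]; exact: idealMl.
apply: Cno; exists 1%N; rewrite ideal_exp1 // => a /nilp[n /BC]; exact: primeX.
Qed.

(* For D the intersection, an ideal B above L + mD maximal with B /\ D = L + mD
   contains a power of m, so D = L + mD. *)
Lemma krull_intersection m L : maximal_ideal m -> is_ideal L ->
  \bigcap_n ideal_add L (ideal_exp m n) `<=` saturation m L.
Proof.
move=> mm hL; have hmp := maximal_prime mm; have hm := prime_ideal_ideal hmp.
set D := \bigcap_n _.
have hLn n : is_ideal (ideal_add L (ideal_exp m n)) by exact: ideal_addP.
have hD : is_ideal D.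
  split=> [n _|a b Da Db n _|r a Da n _]; first exact: ideal0.
    by apply: idealD => //; [exact: Da|exact: Db].
  by apply: idealMl => //; exact: Da.
have hE : is_ideal (ideal_add L (ideal_mul m D)) by exact: ideal_addP.
apply: local_nakayama => //; apply: subset_trans _ (sub_saturation hmp).
have [||B [[hB BD] EB Bmax]] := @noetherian_max
    [set B | is_ideal B /\ B `&` D `<=` ideal_add L (ideal_mul m D)]
    (ideal_add L (ideal_mul m D)); first by move=> ? [].
- by split=> // a [].
have [n hn] : exists n, ideal_exp m n `<=` B.
  apply: exp_sub_of_nilpotent => // x mx.
  (* Once [B : x^k] is stable, an element [d = b + r * x^k] of [D] has [r * x^(k+1) = x * d - x * b]
     in [B], hence [r * x^k] in [B]. So adding [x^k] to [B] does not enlarge the intersection with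
     [D]. *)
  have [||k hk] := @noetherian_chain (fun k => colon_elt B (x ^+ k)).
  - by move=> k; exact: ideal_colon_elt.
  - by move=> k a; rewrite /colon_elt /= exprS mulrCA; exact: idealMl.
  exists k; have hBx : is_ideal (ideal_add B (multiples (x ^+ k))) by exact: ideal_addP.
  rewrite -(Bmax (ideal_add B (multiples (x ^+ k)))).
  - by apply: add_subr => //; exact: mem_multiples.
  - split=> // d [[b Bb [_ [r _ <-] e]] Dd]; apply: BD; split=> //.
    rewrite -e; apply: idealD => //.
    suff : colon_elt B (x ^+ k.+1) r by rewrite hk.
    rewrite /colon_elt /=.
    have -> : r * x ^+ k.+1 = x * d - x * b by rewrite -e exprS; ring.
    apply: idealB => //; last exact: idealMl.
    by apply: EB; apply: add_subr => //; exact: mem_mul.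
  - exact: add_subl.
move=> d Dd; apply: BD; split=> //.
have LB : L `<=` B by apply: subset_trans _ EB; exact: add_subl.
by have := Dd n I; apply: add_sub.
Qed.

End Noetherian.

(** * Homogeneous forms over [R] and their values *)

Section Forms.
Context {R : comNzRingType}.
Implicit Types (I J m : set R) (s : seq R) (n d : nat).

Definition coef_in n I : set {mpoly R[n]} := [set F | forall k, I F@_k].

Lemma ideal_coef_in {n I} : is_ideal I -> is_ideal (@coef_in n I).
Proof.
move=> hI; split=> [k|F G hF hG k|F G hG k].
- by rewrite mcoeff0; exact: ideal0.
- by rewrite mcoeffD; apply: idealD.
- by rewrite mcoeffM; apply: ideal_sum => // i _; apply: idealMl.
Qed.

Lemma coef_inZX {n I c k} : is_ideal I -> I c -> @coef_in n I (c *: 'X_[k]).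
Proof. by move=> hI Ic l; rewrite mcoeffZ; apply: idealMr. Qed.

Lemma coef_in_meval n I F (v : 'I_n -> R) :
  is_ideal I -> coef_in I F -> I F.@[v].
Proof. by move=> hI hF; rewrite mevalE; apply: ideal_sum => // k _; apply: idealMr. Qed.

Lemma prod_exp_mem n m (v : 'I_n -> R) (k : 'X_{1..n}) :
  (forall i, m (v i)) -> ideal_exp m (mdeg k) (\prod_i v i ^+ k i).
Proof.
move=> hv; rewrite mdegE; elim/big_ind2: _ => // [a b c d|i _]; first exact: mem_expD.
exact: mem_expX.
Qed.

Lemma meval_dhomog_mem n I m F d (v : 'I_n -> R) : is_ideal I ->
  (forall i, m (v i)) -> F \is d.-homog for mdeg -> coef_in I F ->
  ideal_mul I (ideal_exp m d) F.@[v].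
Proof.
move=> hI hv /dhomogP hF IF; rewrite mevalE big_seq_cond.
apply: ideal_sum => // k /andP[/hF <- _]; apply: mem_mul => //.
exact: prod_exp_mem.
Qed.

Lemma meval_scale n F d c (v : 'I_n -> R) : F \is d.-homog for mdeg ->
  F.@[fun i => c * v i] = c ^+ d * F.@[v].
Proof.
move=> /dhomogP hF; rewrite !mevalE mulr_sumr big_seq_cond [RHS]big_seq_cond.
apply: eq_bigr => k /andP[/hF <- _]; rewrite mulrCA; congr (_ * _).
rewrite /= mdegE -prodrXr -big_split /=; apply: eq_bigr => i _.
by rewrite exprMn.
Qed.

Lemma meval_congr n I m F d (u v : 'I_n -> R) :
  (forall i, m (u i)) -> (forall i, m (v i)) -> (forall i, I (u i - v i)) ->
  F \is d.-homog for mdeg -> ideal_mul I (ideal_exp m d.-1) (F.@[u] - F.@[v]).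
Proof.
move=> hu hv huv /dhomogP hF.
(* Telescoping: [a a' - b b' = b' (a - b) + a (a' - b')] makes [E] multiplicative. The truncated
   [e.-1] at [e = 0] is only met for the pair [1, 1], whose difference is 0. *)
pose E e a b := [/\ ideal_exp m e a, ideal_exp m e b
  & ideal_mul I (ideal_exp m e.-1) (a - b)].
have E0 : E 0%N 1 1 by split=> //; rewrite subrr; exact: ideal0.
have EM e a b e' a' b' : E e a b -> E e' a' b' -> E (e + e')%N (a * a') (b * b').
  move=> [ea eb eab] [ea' eb' eab']; split; try exact: mem_expD.
  have -> : a * a' - b * b' = b' * (a - b) + a * (a' - b') by ring.
  have mulE e1 e2 c c' : ideal_exp m e1 c -> ideal_mul I (ideal_exp m e2) c' ->
      ideal_mul I (ideal_exp m (e1 + e2)) (c * c').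
    rewrite addnC ideal_expD => hc hc'.
    by rewrite mulrC; apply: mul_mulr.
  apply: (idealD (ideal_mulP _ _)).
    have := mulE _ _ _ _ eb' eab; apply: mul_mono => //; apply: exp_le.
    by case: (e) => [|e0] /=; rewrite ?add0n ?addn0 ?leq_pred // addnC.
  have := mulE _ _ _ _ ea eab'; apply: mul_mono => //; apply: exp_le.
  by case: (e') => [|e0] /=; rewrite ?addn0 ?leq_pred // ?addnS.
have E1 i : E 1%N (u i) (v i).
  split.
  - by have := mem_expX 1 (hu i); rewrite expr1.
  - by have := mem_expX 1 (hv i); rewrite expr1.
  - by rewrite -[_ - _]mulr1; apply: mem_mul.
have EX i j : E j (u i ^+ j) (v i ^+ j).
  by elim: j => // j ih; rewrite -add1n !exprD !expr1; apply: EM.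
have Eprod (k : 'X_{1..n}) : E (mdeg k) (\prod_i u i ^+ k i) (\prod_i v i ^+ k i).
  rewrite mdegE; elim: (index_enum _) => [|i r ih]; first by rewrite !big_nil.
  by rewrite !big_cons; apply: EM.
rewrite !mevalE -sumrB big_seq_cond; apply: ideal_sum => // k /andP[/hF dk _].
rewrite -mulrBr; apply: (idealMl (ideal_mulP _ _)).
by have [_ _] := Eprod k; rewrite dk.
Qed.

Definition ev s : {mpoly R[size s]} -> R := meval (fun i => s`_i).

Lemma exp_ev s d a : ideal_exp (ideal_gen [set` s]) d a ->
  exists2 F : {mpoly R[size s]}, F \is d.-homog for mdeg & ev F = a.
Proof.
elim: d a => [|d ih] a.
  move=> _; exists a%:MP; last by rewrite /ev mevalC.
  by rewrite -[a%:MP]mulr1 mul_mpolyC; apply: dhomogZ; exact: dhomog1.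
apply: (@mul_sub _ _ _ [set b | exists2 F : {mpoly R[size s]},
  F \is d.+1.-homog for mdeg & ev F = b]) => [|b c].
  split=> [|_ _ [F hF <-] [G hG <-]|r _ [F hF <-]].
  - by exists 0; [exact: dhomog0|rewrite /ev meval0].
  - by exists (F + G); [exact: dhomogD|rewrite /ev mevalD].
  - by exists (r *: F); [exact: dhomogZ|rewrite /ev mevalZ].
move=> /gen_seqP[e ->] /ih[F hF <-].
exists (\sum_i e i *: 'X_i * F).
  apply: rpred_sum => i _; rewrite -add1n; apply: dhomogM => //; apply: dhomogZ.
  by rewrite dhomogX; apply/eqP; exact: mdeg1.
rewrite /ev rmorph_sum mulr_suml; apply: eq_bigr => i _.
by rewrite /= mevalM mevalZ mevalXU.
Qed.

Lemma mul_exp_ev s I d a : is_ideal I ->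
  ideal_mul I (ideal_exp (ideal_gen [set` s]) d) a ->
  exists F : {mpoly R[size s]}, [/\ F \is d.-homog for mdeg, coef_in I F & ev F = a].
Proof.
move=> hI; apply: (@mul_sub _ _ _ [set b | exists F : {mpoly R[size s]},
  [/\ F \is d.-homog for mdeg, coef_in I F & ev F = b]]) => [|b c Ib].
  have hC := @ideal_coef_in (size s) I hI.
  split=> [|_ _ [F [hF IF <-]] [G [hG IG <-]]|r _ [F [hF IF <-]]].
  - by exists 0; split; [exact: dhomog0|exact: (ideal0 hC)|rewrite /ev meval0].
  - by exists (F + G); split; [exact: dhomogD|exact: (idealD hC)|rewrite /ev mevalD].
  - exists (r *: F); split; [exact: dhomogZ| |by rewrite /ev mevalZ].
    by rewrite -mul_mpolyC; exact: (idealMl hC).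
move=> /exp_ev[F hF <-]; exists (b *: F); split; [exact: dhomogZ| |by rewrite /ev mevalZ].
by move=> k; rewrite mcoeffZ; exact: idealMr.
Qed.

Lemma ev_exp s m F d : is_ideal m -> [set` s] `<=` m ->
  F \is d.-homog for mdeg -> ideal_exp m d (@ev s F).
Proof.
move=> hm sm hF; rewrite -(ideal_mulr1 (ideal_expP m d)) ideal_mulC.
by apply: meval_dhomog_mem => // i; apply: sm; exact: mem_nth.
Qed.

Lemma dhomog0_const n (F : {mpoly R[n]}) : F \is 0.-homog for mdeg -> F = (F@_0%MM)%:MP.
Proof.
move=> hF; apply/mpolyP => k; rewrite mcoeffC.
have [->|k0] := eqVneq k 0%MM; first by rewrite mulr1.
by rewrite (dhomog_nemf_coeff hF) ?mdeg_eq0 // mulr0.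
Qed.

(** The usual bound on roots over the domain [R/m], lifted to [R]: if [p(a)] lies in [m], then
    [X - a] divides [p - p(a)], and the quotient is still nonzero modulo [m]. *)
Lemma poly_roots_finite m (p : {poly R}) : prime_ideal m -> (exists i, ~ m p`_i) ->
  exists t : seq R, forall c, m p.[c] -> exists2 a, a \in t & m (c - a).
Proof.
move=> hm; have hmi := prime_ideal_ideal hm.
move: {2}(size p) (leqnn (size p)) => k; elim: k p => [|k ih] p sp [i pi].
  by case: pi; rewrite nth_default ?(leq_trans sp) //; exact: ideal0.
case: (pselect (exists a, m p.[a])) => [[a pa]|hno]; last first.
  by exists [::] => c pc; case: hno; exists c.
have /factor_theorem[q eq] : root (p - p.[a]%:P) a by rewrite /root !hornerE subrr.
have ep : p = q * ('X - a%:P) + p.[a]%:P by rewrite -eq subrK.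
have [j qj] : exists j, ~ m q`_j.
  apply: contrapT => /forallNP hq; apply: pi; rewrite ep coefD coefC.
  have {}hq j : m q`_j by have := hq j; move/contrapT.
  apply: idealD => //; last by case: ifP => // _; exact: ideal0.
  rewrite mulrBr coefB coefMX coefMC; apply: idealB => //; last exact: idealMr.
  by case: ifP => // _; exact: ideal0.
have [|t ht] := ih q _ (ex_intro _ j qj).
  have q0 : q != 0 by apply/eqP => q0; apply: qj; rewrite q0 coef0; exact: ideal0.
  have : (size (q * ('X - a%:P))%R <= k.+1)%N.
    rewrite -eq; apply: leq_trans (size_polyD _ _) _; rewrite size_polyN geq_max sp /=.
    by apply: leq_trans (size_polyC_leq1 _) _.
  by rewrite size_Mmonic ?monicXsubC // size_XsubC addn2.
exists (a :: t) => c; rewrite ep !hornerE => /(idealDr hmi pa).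
case: (hm) => _ _ /[apply] -[/ht[b tb mb]|mc]; first by exists b; rewrite // inE tb orbT.
by exists a => //; rewrite mem_head.
Qed.

End Forms.

(** * Points where a polynomial does not vanish, by splitting off the last variable *)

Section Univariate.
Context (R : comNzRingType) (n : nat).
Implicit Types (F : {mpoly R[n.+1]}) (p : {poly {mpoly R[n]}}).

(** Inverse of [muni]: the univariate variable becomes the last of the [n.+1] variables. *)
Definition ununi p : {mpoly R[n.+1]} := (map_poly (@mwiden n R) p).['X_ord_max].

Lemma muniK : cancel (@muni n R) ununi.
Proof.
move=> F; rewrite {2}[F]mpolyE muniE /ununi raddf_sum horner_sum /=.
apply: eq_bigr => k _; rewrite -mul_polyC rmorphM /= map_polyXn map_polyC /=.
rewrite hornerM hornerC hornerXn mwidenZ mwidenX -scalerAl mpolyXn -mpolyXD.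
congr (_ *: 'X_[_]); apply/mnmP => i; rewrite mnmDE mulmnE mnm1E.
have [e|ne] := eqVneq ord_max i.
  by rewrite -e mnmwiden_ordmax mul1n.
have lt_in : (i < n)%N.
  rewrite ltn_neqAle -ltnS ltn_ord andbT; apply: contra_neq ne => e.
  by apply: val_inj; rewrite /= e.
have -> : i = widen_ord (leqnSn n) (Ordinal lt_in) by apply: val_inj.
by rewrite mnmwiden_widen mnmE mul0n addn0.
Qed.

Lemma meval_muni F (c : 'I_n.+1 -> R) :
  F.@[c] = (map_poly (meval (fun i : 'I_n => c (widen_ord (leqnSn n) i))) (muni F)).[c ord_max].
Proof.
rewrite {1}[F]mpolyE muniE !raddf_sum horner_sum /=; apply: eq_bigr => k _.
rewrite -mul_polyC rmorphM /= map_polyXn map_polyC /= hornerM hornerC hornerXn.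
rewrite !mevalZ !mevalX.
rewrite big_ord_recr /= mulrA; congr (_ * _ * _); apply: eq_bigr => i _.
by rewrite mnmE.
Qed.

End Univariate.

Section NonRoot.
Context {R : comNzRingType}.
Variables (m C : set R).
Hypothesis hm : prime_ideal m.
Hypothesis C_inf : forall t : seq R, exists2 c, C c & forall a, a \in t -> ~ m (c - a).

Lemma coef_in_mwiden n (F : {mpoly R[n]}) : coef_in m F -> coef_in m (mwiden F).
Proof.
move=> hF; rewrite (mwidenE (k := msize F)) //.
have hmi := prime_ideal_ideal hm.
apply: (ideal_sum (ideal_coef_in hmi)) => k _.
by apply: coef_inZX.
Qed.

(** The first [n] coordinates are chosen so that some coefficient of [F] in the last variable stays
    outside [m]; the last coordinate then avoids finitely many classes. *)
Lemma exists_nonroot n (F : {mpoly R[n]}) : ~ coef_in m F ->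
  exists c : 'I_n -> R, (forall i, C (c i)) /\ ~ m F.@[c].
Proof.
have hmi := prime_ideal_ideal hm.
elim: n F => [|n ih] F hF.
  have F0 : F \is 0.-homog for mdeg.
    by apply/dhomogP => k _; rewrite /= mdegE big_ord0.
  exists (fun=> 0); split=> [[]//|]; move: hF; rewrite (dhomog0_const F0) mevalC.
  apply: contra_not => h k; rewrite mcoeffC; exact: idealMr.
have [j hj] : exists j, ~ coef_in m (muni F)`_j.
  apply: contrapT => /forallNP h; apply: hF; rewrite -(muniK F) /ununi horner_coef.
  have hc := ideal_coef_in (n := n.+1) hmi.
  apply: (ideal_sum hc) => i _; apply: (idealMr hc); rewrite coef_map /=.
  by apply: coef_in_mwiden; exact: (contrapT (h i)).
have [c' [Cc' hc']] := ih _ hj.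
have [|t ht] := @poly_roots_finite _ m (map_poly (meval c') (muni F)) hm.
  by exists j; rewrite coef_map.
have [c Cc hc] := C_inf t.
pose e (i : 'I_n.+1) := if insub (i : nat) is Some i' then c' i' else c.
exists e; split; first by move=> i; rewrite /e; case: insubP.
have e_max : e ord_max = c by rewrite /e insubF // ltnn.
have e_widen i : e (widen_ord (leqnSn n) i) = c' i.
  by rewrite /e; case: insubP => [i' _ /val_inj->//|]; rewrite /= ltn_ord.
rewrite meval_muni e_max (eq_map_poly (g := meval c')) => [/ht[a ta]|p].
  exact: hc.
exact: meval_eq.
Qed.

End NonRoot.

(** * The frame common to both settings, and reductions in it *)

Lemma least_exists (P : nat -> Prop) : (exists n, P n) -> exists n, least P n.
Proof.
case=> n; elim/ltn_ind: n => n ih Pn.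
case: (pselect (exists2 k, P k & (k < n)%N)) => [[k Pk kn]|hno]; first exact: ih Pk.
by exists n; split=> // k Pk; rewrite leqNgt; apply/negP => kn; apply: hno; exists k.
Qed.

(* The features common to the local and to the graded setting.  In the graded
   setting V is the set of linear forms and C the coefficient field, so that
   ideals generated by C-combinations of elements of V are homogeneous. *)
Record frame (R : comNzRingType) (m : set R) (adm : set (set R)) (V C : set R) :
    Prop := Frame {
  frame_noetherian : noetherian R;
  frame_max : maximal_ideal m;
  frame_ideal : forall I, adm I -> is_ideal I;
  frame_sat : forall I, adm I -> saturated m I;
  frame_T : adm setT;
  frame_m : adm m;
  frame_mul : forall I J, adm I -> adm J -> adm (ideal_mul I J);
  frame_add : forall I J, adm I -> adm J -> adm (ideal_add I J);
  frame_gen : forall s : seq R, [set` s] `<=` V -> adm (ideal_gen [set` s]);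
  frame_Vm : V `<=` m;
  frame_V0 : V 0;
  frame_VB : forall a b, V a -> V b -> V (a - b);
  frame_VZ : forall c a, C c -> V a -> V (c * a);
  frame_C : forall r, exists2 c, C c & m (r - c);
  frame_inf : forall t : seq R, exists2 c, C c & forall a, a \in t -> ~ m (c - a);
  frame_gens : exists2 s : seq R, [set` s] `<=` V & m = ideal_gen [set` s]
}.

Lemma size_others n (T : Type) (f : 'I_n -> T) (j : 'I_n) :
  (size [seq f i | i <- enum 'I_n & i != j] < n)%N.
Proof.
rewrite size_map size_filter -[X in (_ < X)%N](size_enum_ord n).
rewrite -(count_predC (fun i => i != j)) -[X in (X < _)%N]addn0 ltn_add2l.
rewrite -has_count; apply/hasP; exists j; first by rewrite mem_enum.
by rewrite /= negbK.
Qed.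

Section Frame.
Context {R : comNzRingType} {m : set R} {adm : set (set R)} {V C : set R}.
Hypothesis fr : frame m adm V C.
Implicit Types (I J L : set R) (s z : seq R).

Let mmax : maximal_ideal m := frame_max fr.
Let mprime : prime_ideal m := maximal_prime mmax.
Let mideal : is_ideal m := prime_ideal_ideal mprime.

Lemma frame_exp n : adm (ideal_exp m n).
Proof. by elim: n => [|n ih]; [exact: (frame_T fr)|exact: (frame_mul fr (frame_m fr) ih)]. Qed.

Lemma frame_multiples a : V a -> adm (multiples a).
Proof.
move=> Va; suff -> : multiples a = ideal_gen [set` [:: a]].
  by apply: (frame_gen fr) => b; rewrite /= inE => /eqP->.
apply/seteqP; split; first by apply: multiples_sub => //; apply: sub_gen; rewrite /= inE.
by apply: gen_sub => // b; rewrite /= inE => /eqP->; exact: mem_multiples.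
Qed.

(** Coefficients may be replaced by representatives in [C] at the cost of an error in [m^2]; so [V]
    maps onto [m/m^2]. *)
Lemma frame_approx a : m a -> exists2 v, V v & ideal_mul m m (a - v).
Proof.
have [s sV ms] := frame_gens fr; rewrite {1}ms => /gen_seqP[c ->].
have /choice[e he] : forall i, exists e, C e /\ m (c i - e).
  by move=> i; have [e Ce me] := frame_C fr (c i); exists e.
exists (\sum_i e i * s`_i).
  elim/big_ind: _ => [|x y Vx Vy|i _]; first exact: (frame_V0 fr).
    have -> : x + y = x - (0 - y) by ring.
    by apply: (frame_VB fr) => //; apply: (frame_VB fr) => //; exact: (frame_V0 fr).
  by apply: (frame_VZ fr); [exact: (he i).1|apply: sV; exact: mem_nth].
rewrite -sumrB; apply: ideal_sum => // i _; rewrite -mulrBl; apply: mem_mul.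
  exact: (he i).2.
by apply: (frame_Vm fr); apply: sV; exact: mem_nth.
Qed.

Lemma frame_nakayama N L : is_ideal N -> adm L ->
  N `<=` ideal_add L (ideal_mul m N) -> N `<=` L.
Proof.
move=> hN aL NL; apply: subset_trans _ (saturation_sub (frame_sat fr aL)).
apply: (local_nakayama (frame_noetherian fr)) => //; first exact: (frame_ideal fr).
apply: subset_trans NL _; exact: sub_saturation.
Qed.

Lemma frame_krull a L : adm L ->
  (forall d, ideal_add L (ideal_exp m d) a) -> L a.
Proof.
move=> aL h; apply: (saturation_sub (frame_sat fr aL)).
apply: (krull_intersection (frame_noetherian fr)) => //; exact: (frame_ideal fr).
Qed.

(** From [m = J + (x)] follows [m^(d+1) = J m^d + (x^(d+1))], so only the power of [x] remains to be
    tested. *)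
Lemma reduction_expS J (x : R) d : is_ideal J -> J `<=` m -> m x -> m `<=` ideal_add J (multiples x) ->
  ideal_mul J (ideal_exp m d) (x ^+ d.+1) -> ideal_mul J (ideal_exp m d) = ideal_exp m d.+1.
Proof.
move=> hJ Jm mx mJx hx.
have mle e : ideal_exp m e.+1 `<=`
    ideal_add (ideal_mul J (ideal_exp m e)) (multiples (x ^+ e.+1)).
  have hK k : is_ideal (ideal_add (ideal_mul J (ideal_exp m k)) (multiples (x ^+ k.+1))).
    exact: ideal_addP.
  elim: e => [|e ih]; first by rewrite ideal_exp1 // ideal_mulr1.
  apply: mul_sub => // a b /mJx[j Jj [_ [r _ <-] <-]] mb.
  rewrite mulrDl; apply: (idealD (hK _)); first by apply: add_subl => //; exact: mem_mul.
  have [c Jc [_ [t _ <-] <-]] := ih _ mb; rewrite mulrDr; apply: (idealD (hK _)).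
    apply: add_subl => //; rewrite -mulrA; apply: (idealMl (ideal_mulP _ _)).
    rewrite mulrC ideal_expS [ideal_mul m _]ideal_mulC.
    exact: mul_mulr.
  apply: add_subr => //; exists (r * t) => //.
  by rewrite [in RHS]mulrACA -exprS.
apply/seteqP; split; first exact: mul_mono.
apply: subset_trans (mle d) _; apply: add_sub => //; exact: multiples_sub.
Qed.

(* With F(c) and c_j outside m, the z_i = c_j s_i - c_i s_j satisfy
   0 = F(c_j s) = F(c) s_j^d modulo (z) m^(d-1). *)
Lemma reduction_relation s d (F : {mpoly R[size s]}) :
  [set` s] `<=` V -> m = ideal_gen [set` s] ->
  F \is d.-homog for mdeg -> ev F = 0 -> ~ coef_in m F ->
  exists z, [/\ [set` z] `<=` V, (size z < size s)%N & reduction adm m (ideal_gen [set` z])].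
Proof.
move=> sV ms hF F0 hmF; case: d hF => [|d] hF.
  case: hmF => k; move: F0; rewrite (dhomog0_const hF) /ev mevalC => ->.
  by rewrite mpolyC0 mcoeff0; exact: ideal0.
have sm (i : 'I_(size s)) : V s`_i by apply: sV; exact: mem_nth.
have smm (i : 'I_(size s)) : m s`_i by exact: (frame_Vm fr).
have [c [Cc Fc]] := exists_nonroot mprime (frame_inf fr) hmF.
(* [F] has positive degree, so a value outside [m] needs a coordinate outside [m]; [frame_sat] then
   cancels it like a unit. *)
have [j cj] : exists j, ~ m (c j).
  apply: contrapT => /forallNP h; apply: Fc.
  have := @meval_dhomog_mem _ _ setT m F d.+1 c (@idealT R) _ hF.
  rewrite ideal_mulC ideal_mulr1 // => hc.
  by apply: (mul_subl mideal); apply: hc => // i; exact: (contrapT (h i)).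
pose z := [seq c j * s`_i - c i * s`_j | i : 'I_(size s) <- enum 'I_(size s) & i != j].
have zV : [set` z] `<=` V.
  move=> _ /= /mapP[i _ ->]; apply: (frame_VB fr); exact: (frame_VZ fr).
set J := ideal_gen [set` z]; have aJ : adm J by exact: (frame_gen fr).
have hJ : is_ideal J by exact: (frame_ideal fr).
have Jm : J `<=` m by apply: gen_sub => //; apply: subset_trans zV _; exact: (frame_Vm fr).
have Jz (i : 'I_(size s)) : J (c j * s`_i - c i * s`_j).
  have [->|ij] := eqVneq i j; first by rewrite subrr; exact: ideal0.
  by apply: sub_gen; apply: map_f; rewrite mem_filter ij mem_enum.
have aJm k : adm (ideal_mul J (ideal_exp m k)).
  by apply: (frame_mul fr) => //; exact: frame_exp.
exists z; split=> //; first exact: size_others.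
split=> //; exists d; apply: (@reduction_expS J s`_j) => //.
  rewrite {1}ms; apply: gen_seq_sub => [|i si]; first exact: ideal_addP.
  apply: (frame_sat fr _ cj).
    by apply: (frame_add fr) => //; exact: frame_multiples.
  exists (c j * s`_i - c (Ordinal si) * s`_j); first exact: (Jz (Ordinal si)).
  by exists (c (Ordinal si) * s`_j); [exists (c (Ordinal si))|ring].
apply: (frame_sat fr (aJm d) Fc).
have := @meval_congr _ _ J m F d.+1 (fun i => c j * s`_i) (fun i => s`_j * c i).
rewrite !(meval_scale _ _ hF) -/(ev F) F0 mulr0 sub0r mulrC => h.
rewrite -(opprK (_ * _)); apply: (idealN (ideal_mulP _ _)); apply: h => // i.
- exact: idealMl.
- exact: idealMr.
- by rewrite [s`_j * _]mulrC.
Qed.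

Lemma exists_minimal_gens : exists s, [/\ [set` s] `<=` V, m = ideal_gen [set` s]
  & forall t, [set` t] `<=` V -> m = ideal_gen [set` t] -> (size s <= size t)%N].
Proof.
have [|n [[s [sV ms <-]] smin]] := @least_exists
    (fun n => exists s, [/\ [set` s] `<=` V, m = ideal_gen [set` s] & size s = n]).
  by have [s sV ms] := frame_gens fr; exists (size s), s.
by exists s; split=> // t tV mt; apply: smin; exists t.
Qed.

(** A coefficient outside [m] could be cancelled by [frame_sat], and its generator would be
    redundant. *)
Lemma minimal_gens_independent s (c : 'I_(size s) -> R) :
  [set` s] `<=` V -> m = ideal_gen [set` s] ->
  (forall t, [set` t] `<=` V -> m = ideal_gen [set` t] -> (size s <= size t)%N) ->
  \sum_i c i * s`_i = 0 -> forall i, m (c i).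
Proof.
move=> sV ms smin c0 j; apply: contrapT => cj.
pose t := [seq s`_i | i : 'I_(size s) <- enum 'I_(size s) & i != j].
have tV : [set` t] `<=` V by move=> _ /= /mapP[i _ ->]; apply: sV; exact: mem_nth.
have tn (i : 'I_(size s)) : i != j -> ideal_gen [set` t] s`_i.
  by move=> ij; apply: sub_gen; apply: map_f; rewrite mem_filter ij mem_enum.
have /smin : m = ideal_gen [set` t]; last by move/(_ tV); rewrite leqNgt size_others.
apply/seteqP; split; last by apply: gen_sub => // a /tV; exact: (frame_Vm fr).
rewrite {1}ms; apply: gen_seq_sub => // i si.
have [ei|] := eqVneq (Ordinal si) j; last exact: tn.
rewrite (_ : s`_i = s`_j); last by rewrite -ei.
apply: (frame_sat fr (frame_gen fr tV) cj); move: c0; rewrite (bigD1 j) //=.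
move/eqP; rewrite addr_eq0 => /eqP->; apply: (idealN (ideal_genP _)).
by apply: ideal_sum => // k kj; apply: (idealMl (ideal_genP _)); exact: tn.
Qed.

Lemma reduction_m : reduction adm m m.
Proof. by split; [exact: (frame_m fr)|by []|exists 0%N]. Qed.

(* A reduction generated by as few elements z of V as possible is minimal: a
   reduction strictly below (z) would allow one to discard one generator. *)
Lemma exists_minimal_reduction : exists I, minimal_reduction adm m I.
Proof.
have [|n [[z [zV zred zn]] zmin]] := @least_exists (fun n => exists z : seq R,
    [/\ [set` z] `<=` V, reduction adm m (ideal_gen [set` z]) & size z = n]).
  have [s sV ms] := frame_gens fr; exists (size s), s; split=> //.
  by rewrite -ms; exact: reduction_m.
set J := ideal_gen [set` z] in zred *; exists J; split=> // J' [aJ' J'm [r J'r]] J'J.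
have [aJ Jm _] := zred; have hJ := frame_ideal fr aJ; have hJ' := frame_ideal fr aJ'.
apply/seteqP; split=> //; apply: contrapT => JJ'.
have amJ : adm (ideal_mul m J) by apply: (frame_mul fr) => //; exact: (frame_m fr).
(* [L] is the preimage of a hyperplane of [J/mJ] containing the image of [J']; Nakayama keeps
   [J' + m J] different from [J]. *)
have [||L [[aL LJ JL] J'L Lmax]] := @noetherian_max _ (frame_noetherian fr)
    [set L | [/\ adm L, L `<=` J & ~ J `<=` L]] (ideal_add J' (ideal_mul m J)).
- by move=> L [aL _ _]; exact: (frame_ideal fr).
- split; first exact: (frame_add fr).
    by apply: add_sub => //; exact: mul_subr.
  by move=> h; apply: JJ'; exact: (frame_nakayama hJ aJ' h).
have hL := frame_ideal fr aL.
have [j Lj] : exists j : 'I_(size z), ~ L z`_j.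
  apply: contrapT => /forallNP h; apply: JL; apply: gen_seq_sub => // i si.
  exact: (contrapT (h (Ordinal si))).
have Jz (i : 'I_(size z)) : J z`_i by exact: mem_gen_nth.
have Vz (i : 'I_(size z)) : V z`_i by apply: zV; exact: mem_nth.
have JLz : J `<=` ideal_add L (multiples z`_j).
  apply: contrapT => h; apply: Lj; rewrite -(Lmax (ideal_add L (multiples z`_j))).
  - by apply: add_subr => //; exact: mem_multiples.
  - split=> //; first by apply: (frame_add fr) => //; exact: frame_multiples.
    by apply: add_sub => //; apply: multiples_sub.
  - exact: add_subl.
have mJL : ideal_mul m J `<=` L by apply: subset_trans J'L; exact: add_subr.
have /choice[c hc] : forall i : 'I_(size z), exists c, C c /\ L (z`_i - c * z`_j).
  move=> i; have [l Ll [_ [e _ <-] ei]] := JLz _ (Jz i).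
  have [c Cc me] := frame_C fr e; exists c; split=> //.
  rewrite -ei; have -> : l + e * z`_j - c * z`_j = l + (e - c) * z`_j by ring.
  by apply: idealD => //; apply: mJL; exact: mem_mul.
(* Modulo [m J] these span [L], with fewer generators than [z]. *)
pose w := [seq z`_i - c i * z`_j | i : 'I_(size z) <- enum 'I_(size z) & i != j].
have wV : [set` w] `<=` V.
  move=> _ /= /mapP[i _ ->]; apply: (frame_VB fr) => //.
  by apply: (frame_VZ fr) => //; exact: (hc i).1.
set W := ideal_gen [set` w]; have aW : adm W by exact: (frame_gen fr).
have hW := frame_ideal fr aW.
have WL : W `<=` L by apply: gen_sub => // _ /= /mapP[i _ ->]; exact: (hc i).2.
have LW : L `<=` ideal_add W (ideal_mul m J).
  move=> l Ll; have /gen_seqP[a el] := LJ _ Ll.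
  pose b := a j + \sum_(i | i != j) a i * c i.
  pose l' := \sum_(i | i != j) a i * (z`_i - c i * z`_j).
  have Wl' : W l'.
    apply: (ideal_sum hW) => i ij; apply: (idealMl hW).
    by apply: sub_gen; apply: map_f; rewrite mem_filter ij mem_enum.
  have ell : l = l' + b * z`_j.
    rewrite el (bigD1 j) //= mulrDl mulr_suml addrCA; congr (_ + _).
    by rewrite -big_split /=; apply: eq_bigr => i _; ring.
  rewrite ell; apply: mem_add => //; apply: mem_mul => //; apply: contrapT => mb.
  apply: Lj; apply: (frame_sat fr aL mb).
  have -> : b * z`_j = l - l' by rewrite ell; ring.
  by apply: idealB => //; exact: WL.
have Wm : W `<=` m by apply: subset_trans WL _; exact: subset_trans LJ Jm.
have : (n <= size w)%N; last by rewrite -zn leqNgt size_others.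
apply: zmin; exists w; split=> //; split=> //; exists r; apply/seteqP; split.
  exact: mul_mono.
have aWr : adm (ideal_mul W (ideal_exp m r)) by apply: (frame_mul fr) => //; exact: frame_exp.
(* As [J'] lies in [W + m J], the ideal [m^(r+1) = J' m^r] lies in [W m^r + m m^(r+1)]. *)
apply: frame_nakayama => //; rewrite -{1}J'r; apply: mul_sub; first exact: ideal_addP.
move=> a b J'a mb.
have [w0 Ww0 [k mJk <-]] : ideal_add W (ideal_mul m J) a.
  by apply: LW; apply: J'L; apply: add_subl.
rewrite mulrDl; apply: mem_add; first exact: mem_mul.
apply: (mul_mono (I' := m) _ _ (mul_mulr _ mJk mb)) => //.
exact: mul_mono.
Qed.

End Frame.

(** * Free generators: regular sequences and colon ideals *)

Section FormFree.
Context {R : comNzRingType}.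
Implicit Types (m : set R) (s : seq R).

Definition form_free m s := forall d (F : {mpoly R[size s]}),
  F \is d.-homog for mdeg -> ev F = 0 -> coef_in m F.

Lemma form_free_independent m s (c : 'I_(size s) -> R) :
  form_free m s -> \sum_i c i * s`_i = 0 -> forall i, m (c i).
Proof.
move=> free c0 i; have := free 1%N (\sum_j c j *: 'X_j).
have hF : \sum_j c j *: 'X_j \is 1.-homog for mdeg.
  by apply: rpred_sum => j _; apply: dhomogZ; rewrite dhomogX; apply/eqP; exact: mdeg1.
have eF : ev (\sum_j c j *: 'X_j) = \sum_j c j * s`_j.
  by rewrite /ev rmorph_sum; apply: eq_bigr => j _; rewrite /= mevalZ mevalXU.
rewrite eF => /(_ hF c0 U_(i)%MM); rewrite raddf_sum (bigD1 i) //= big1.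
  by rewrite mcoeffZ mcoeffXU eqxx mulr1 addr0.
by move=> j ji; rewrite mcoeffZ mcoeffXU (negbTE ji) mulr0.
Qed.

Lemma mulXU_coef0 n (i : 'I_n) (H : {mpoly R[n]}) (k : 'X_{1..n}) : k i = 0%N -> (H * 'X_i)@_k = 0.
Proof.
move=> ki; apply/eqP; rewrite mcoeff_eq0 (perm_mem (msuppMX _ _)).
by apply/mapP => -[l _ e]; move: ki; rewrite e mnmDE mnm1E eqxx.
Qed.

Lemma gen_others_sum s (i : 'I_(size s)) a :
  ideal_gen [set s`_j | j in [set j | (j < size s)%N /\ j <> i]] a ->
  exists2 c : 'I_(size s) -> R, c i = 0 & a = \sum_j c j * s`_j.
Proof.
apply: (@gen_sub _ _ [set a | exists2 c : 'I_(size s) -> R, c i = 0 & a = \sum_j c j * s`_j]).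
  split=> [|_ _ [c ci ->] [e ei ->]|r _ [c ci ->]].
  - by exists (fun=> 0); rewrite // big1 // => j _; rewrite mul0r.
  - exists (fun j => c j + e j); rewrite ?ci ?ei ?addr0 // -big_split.
    by apply: eq_bigr => j _; rewrite mulrDl.
  - exists (fun j => r * c j); rewrite ?ci ?mulr0 // mulr_sumr.
    by apply: eq_bigr => j _; rewrite mulrA.
move=> _ [j /= [sj ji] <-]; exists (fun k => (k == Ordinal sj)%:R).
  by case: eqP => // e; case: ji; rewrite e.
rewrite (bigD1 (Ordinal sj)) //= eqxx mul1r big1 ?addr0 // => k /negbTE->.
by rewrite mul0r.
Qed.

End FormFree.

Section FreeFrame.
Context {R : comNzRingType} {m : set R} {adm : set (set R)} {V C : set R}.
Hypothesis fr : frame m adm V C.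
Variable s : seq R.
Hypotheses (sV : [set` s] `<=` V) (ms : m = ideal_gen [set` s]) (free : form_free m s).

Let mprime : prime_ideal m := maximal_prime (frame_max fr).
Let mideal : is_ideal m := prime_ideal_ideal mprime.
Let m1 : ~ m 1. Proof. by case: mprime. Qed.

Let sm : [set` s] `<=` m. Proof. by apply: subset_trans sV _; exact: frame_Vm fr. Qed.

Let snm (i : 'I_(size s)) : m s`_i. Proof. by apply: sm; exact: mem_nth. Qed.

(** An element of [m^(d+1) = m m^d] is also the value of a degree [d] form with coefficients in [m];
    subtracting it reduces to a form vanishing at [s]. *)
Lemma form_free_exp d (F : {mpoly R[size s]}) :
  F \is d.-homog for mdeg -> ideal_exp m d.+1 (ev F) -> coef_in m F.
Proof.
have hC := ideal_coef_in (n := size s) mideal.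
move=> hF; rewrite ideal_expS {2}ms => /(mul_exp_ev mideal)[G [hG mG e]].
have : coef_in m (F - G).
  apply: (free (d := d)); last by rewrite /ev mevalB -!/(ev _) e subrr.
  by apply: dhomogD => //; rewrite dhomogN.
by move=> h; rewrite -(subrK G F); exact: (idealD hC).
Qed.

Let L i := ideal_gen [set` take i s].

Let takeV i : [set` take i s] `<=` V.
Proof. by move=> a /= /mem_take; exact: sV. Qed.

Let admL i : adm (L i). Proof. exact: (frame_gen fr (takeV (i := i))). Qed.

Let idealL i : is_ideal (L i). Proof. exact: ideal_genP. Qed.

Let idealLm i d : is_ideal (ideal_add (L i) (ideal_exp m d)).
Proof. exact: ideal_addP. Qed.

Let mem_L i j : (j < i)%N -> (j < size s)%N -> L i s`_j.
Proof.
move=> ji js; apply: sub_gen => /=; rewrite -(nth_take 0 ji).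
by apply: mem_nth; rewrite size_take; case: ifP.
Qed.

Let L_m i : L i `<=` m.
Proof. by apply: gen_sub => // a /takeV; exact: (frame_Vm fr). Qed.

Let outside i (k : 'X_{1..size s}) := forall j : 'I_(size s), (j < i)%N -> k j = 0%N.

(** The fibre cone of [R] modulo the first [i] generators is polynomial in the remaining ones;
    [outside_ev] is the converse implication. *)
Let free_mod i := forall d (F : {mpoly R[size s]}), F \is d.-homog for mdeg ->
  ideal_add (L i) (ideal_exp m d.+1) (ev F) -> forall k, outside i k -> m F@_k.

Let outside_ev i d (F : {mpoly R[size s]}) : F \is d.-homog for mdeg ->
  (forall k, outside i k -> m F@_k) -> ideal_add (L i) (ideal_exp m d.+1) (ev F).
Proof.
move=> /dhomogP hF mF; rewrite /ev mevalE big_seq_cond.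
apply: (ideal_sum (idealLm i d.+1)) => k /andP[/hF dk _].
case: (pselect (outside i k)) => [/mF mk|/existsNP[j /not_implyP[ji kj]]].
  apply: (add_subr (idealL i)); apply: (@mem_mul _ m (ideal_exp m d)) => //.
  by rewrite -dk; exact: prod_exp_mem.
apply: (add_subl (ideal_expP _ _)); apply: (idealMl (idealL i)).
rewrite (bigD1 j) //=; apply: (idealMr (idealL i)).
case: (k j) kj => // e _; rewrite exprS; apply: (idealMr (idealL i)).
exact: mem_L.
Qed.

(** The variable [X_j] is a nonzerodivisor on this fibre cone. If [a] has order [e] modulo [L i],
    with leading form [F], then [F * X_j] takes a value of order at least [e + 2], so the
    coefficients of [F] that matter are in [m] and the order of [a] rises. *)
Let free_mod_colon i : free_mod i -> forall d a (j : 'I_(size s)), (i <= j)%N ->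
  ideal_add (L i) (ideal_exp m d.+1) (a * s`_j) -> ideal_add (L i) (ideal_exp m d) a.
Proof.
move=> fi d a j ij ha.
suff h e : (e <= d)%N -> ideal_add (L i) (ideal_exp m e) a by exact: h.
elim: e => [_|e ih ed]; first exact: add_subr.
have [l Ll [b mb eab]] := ih (ltnW ed).
have /exp_ev[F hF eF] : ideal_exp (ideal_gen [set` s]) e b by rewrite -ms.
suff : ideal_add (L i) (ideal_exp m e.+1) b.
  move=> [l' Ll' [b' mb' e']]; exists (l + l'); first exact: (idealD (idealL i)).
  by exists b' => //; rewrite -eab -e' addrA.
rewrite -eF; apply: outside_ev => // k ok.
have hFX : F * 'X_j \is e.+1.-homog for mdeg.
  rewrite -addn1; apply: dhomogM => //; rewrite dhomogX; apply/eqP; exact: mdeg1.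
rewrite -(mcoeffMX F U_(j) k); apply: (fi e.+1) => //; last first.
  move=> j' j'i; rewrite mnmDE ok // mnm1E; case: eqP => // ej; move: ij.
  by rewrite ej leqNgt j'i.
rewrite /ev mevalM mevalXU -/(ev F) eF.
have -> : b * s`_j = a * s`_j - l * s`_j by rewrite -eab; ring.
apply: (idealB (idealLm _ _)); last first.
  by apply: add_subl => //; exact: (idealMr (idealL i)).
by have [l' Ll' [b' mb' <-]] := ha; apply: mem_add => //; apply: exp_le mb'.
Qed.

(** In passing from [i] to [i.+1], a value of [F] differs from the previous case by [r * s_i]. By
    [free_mod_colon], [r] has order one less than the degree, so it is the value of a form [H]
    modulo [L i]; [F - H * X_i] has the same coefficients at the monomials free of [X_i]. *)
Let free_modP i : (i <= size s)%N -> free_mod i.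
Proof.
elim: i => [_|i ih si] d F hF.
  move=> [l Ll [b mb e]] k _; apply: (form_free_exp hF); rewrite -e.
  have -> : l = 0.
    apply: (@gen_sub _ _ [set 0] ideal_zero _ _ Ll) => a; by rewrite /= take0.
  by rewrite add0r.
have fi := ih (ltnW si); pose oi := Ordinal si.
have eL : L i.+1 = ideal_add (L i) (multiples s`_i) by exact: gen_take_S.
rewrite eL => -[_ [l Ll [_ [r _ <-] <-]] [b mb e]] k ok.
have mF := ev_exp mideal sm hF; rewrite -/(ev F) in mF.
case: d hF mb mF => [|d] hF mb mF.
  have [->|k0] := eqVneq k 0%MM; last first.
    by rewrite (dhomog_nemf_coeff hF) ?mdeg_eq0 //; exact: ideal0.
  rewrite (_ : F@_0%MM = ev F); last by rewrite {2}(dhomog0_const hF) /ev mevalC.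
  rewrite -e ideal_exp1 // in mb *; apply: idealD => //; apply: idealD => //.
    exact: L_m Ll.
  by apply: idealMl => //; exact: (snm oi).
have : ideal_add (L i) (ideal_exp m d.+1) (r * s`_oi).
  exists (- l); first exact: (idealN (idealL i)).
  exists (ev F - b); last by rewrite -e /=; ring.
  by apply: (idealB (ideal_expP _ _)) => //; apply: exp_le mb.
move=> /(@free_mod_colon i fi d r oi (leqnn i))[l' Ll' [c mc er]].
have /exp_ev[H hH eH] : ideal_exp (ideal_gen [set` s]) d c by rewrite -ms.
have := fi d.+1 (F - H * 'X_oi); rewrite /ev mevalB mevalM mevalXU -!/(ev _) eH.
have hG : F - H * 'X_oi \is d.+1.-homog for mdeg.
  apply: dhomogD => //; rewrite dhomogN -addn1; apply: dhomogM => //.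
  by rewrite dhomogX; apply/eqP; exact: mdeg1.
move=> /(_ hG) h; have /h : ideal_add (L i) (ideal_exp m d.+2) (ev F - c * s`_oi).
  exists (l + l' * s`_oi); last by exists b => //; rewrite -e -er /=; ring.
  by apply: (idealD (idealL i)) => //; apply: (idealMr (idealL i)).
move=> /(_ k); rewrite mcoeffB mulXU_coef0 ?subr0; last exact: ok.
by apply=> j ji; apply: ok; exact: ltnW.
Qed.

(** The order estimate places [a] in [L i + m^d] for every [d], and Krull's intersection theorem
    removes the error. *)
Lemma form_free_colon i j a : (i <= j < size s)%N ->
  ideal_gen [set` take i s] (a * s`_j) -> ideal_gen [set` take i s] a.
Proof.
move=> /andP[ij js] h; apply: (frame_krull fr (admL i)) => d.
apply: (@free_mod_colon i _ d a (Ordinal js)) => //.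
  by apply: free_modP; exact: ltnW (leq_ltn_trans ij js).
exact: add_subl.
Qed.

Lemma form_free_exp_colon d j a : (j < size s)%N ->
  ideal_exp m d.+1 (a * s`_j) -> ideal_exp m d a.
Proof.
move=> js h; have L0 : L 0 = [set 0].
  apply/seteqP; split; last by move=> _ ->; exact: ideal0.
  by apply: gen_sub => // b; rewrite /= take0.
have : ideal_add (L 0) (ideal_exp m d) a.
  apply: (@free_mod_colon 0 _ d a (Ordinal js)) => //; first exact: free_modP.
  exact: add_subr.
by rewrite L0 => -[_ -> [b mb <-]]; rewrite add0r.
Qed.

Lemma form_free_d_sequence : d_sequence s.
Proof.
split=> [i si /(@gen_others_sum _ _ (Ordinal si))[c ci e]|i j /andP[ij js]].
  have e0 : \sum_j ((j == Ordinal si)%:R - c j) * s`_j = 0.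
    under eq_bigr do rewrite mulrBl.
    rewrite sumrB -e (bigD1 (Ordinal si)) //= eqxx mul1r big1 ?addr0 ?subrr // => j.
    by move=> /negbTE->; rewrite mul0r.
  by have := form_free_independent free e0 (Ordinal si); rewrite eqxx ci subr0.
apply/seteqP; split=> a; rewrite /colon_elt /=.
  rewrite mulrA => /form_free_colon h; apply: (idealMr (idealL i)).
  apply: (@form_free_colon i i); first by rewrite leqnn (leq_ltn_trans ij).
  by apply: h; rewrite ij.
by rewrite mulrCA; exact: (idealMl (idealL i)).
Qed.

End FreeFrame.

(** * Free generators give (c) and (d) *)

Section Consequences.
Context {R : comNzRingType} {m : set R} {adm : set (set R)} {V C : set R}.
Hypothesis fr : frame m adm V C.
Variable s : seq R.
Hypotheses (sV : [set` s] `<=` V) (ms : m = ideal_gen [set` s]) (free : form_free m s).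

Let mprime : prime_ideal m := maximal_prime (frame_max fr).
Let mideal : is_ideal m := prime_ideal_ideal mprime.
Let m1 : ~ m 1. Proof. by case: mprime. Qed.
Let sm : [set` s] `<=` m. Proof. by apply: subset_trans sV _; exact: (frame_Vm fr). Qed.

(* For L maximal among the proper admissible ideals above a reduction I and s_j
   outside L, reading the generators modulo L as multiples of s_j gives a
   K-point of the fibre at which all forms in I vanish but X_j does not. *)
Lemma form_free_reduction I : reduction adm m I -> I = m.
Proof.
move=> [aI Im [r Ir]]; apply/seteqP; split=> //; apply: contrapT => mI.
have [||L [[aL Lm mL] IL Lmax]] := @noetherian_max _ (frame_noetherian fr)
    [set L | [/\ adm L, L `<=` m & ~ m `<=` L]] I; try by [].
  by move=> L [aL _ _]; exact: (frame_ideal fr).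
have hL := frame_ideal fr aL.
have [j Lj] : exists j : 'I_(size s), ~ L s`_j.
  apply: contrapT => /forallNP h; apply: mL; rewrite ms; apply: gen_seq_sub => // i si.
  exact: (contrapT (h (Ordinal si))).
have mLs : m `<=` ideal_add L (multiples s`_j).
  apply: contrapT => h; apply: Lj; rewrite -(Lmax (ideal_add L (multiples s`_j))).
  - by apply: add_subr => //; exact: mem_multiples.
  - split=> //.
      apply: (frame_add fr) => //; apply: (frame_multiples fr); apply: sV; exact: mem_nth.
    by apply: add_sub => //; apply: multiples_sub => //; apply: sm; exact: mem_nth.
  - exact: add_subl.
have /choice[c hc] : forall i : 'I_(size s), exists c, L (s`_i - c * s`_j).
  move=> i; have [|l Ll [_ [c _ <-] <-]] := mLs s`_i; first by apply: sm; exact: mem_nth.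
  by exists c; rewrite addrK.
have Lsj a : L (a * s`_j) -> m a.
  by move=> La; apply: contrapT => ma; apply: Lj; exact: (frame_sat fr aL ma).
have cj : ~ m (c j).
  move=> mcj; apply: m1; rewrite -(subrK (c j) 1); apply: idealD => //; apply: Lsj.
  by rewrite mulrBl mul1r; exact: hc.
have vanish a : ideal_mul L (ideal_exp m r) a ->
    exists F : {mpoly R[size s]}, [/\ F \is r.+1.-homog for mdeg, ev F = a & m F.@[c]].
  apply: (@mul_sub _ _ _ [set a | exists F : {mpoly R[size s]},
      [/\ F \is r.+1.-homog for mdeg, ev F = a & m F.@[c]]]).
    split=> [|_ _ [F [hF <- mF]] [G [hG <- mG]]|t _ [F [hF <- mF]]].
    - by exists 0; rewrite /ev !meval0; split; [exact: dhomog0| |exact: ideal0].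
    - exists (F + G); rewrite /ev !mevalD; split; [exact: dhomogD| |exact: idealD] => //.
    - exists (t *: F); rewrite /ev !mevalZ; split; [exact: dhomogZ| |exact: idealMl] => //.
  move=> y b Ly mb; have [G hG <-] : exists2 G : {mpoly R[size s]},
      G \is r.-homog for mdeg & ev G = b by apply: exp_ev; rewrite -ms.
  have /gen_seqP[e ey] : ideal_gen [set` s] y by rewrite -ms; exact: Lm.
  pose l : {mpoly R[size s]} := \sum_i e i *: 'X_i.
  have hl : l \is 1.-homog for mdeg.
    apply: rpred_sum => i _; apply: dhomogZ; rewrite dhomogX; apply/eqP; exact: mdeg1.
  have evl v : l.@[v] = \sum_i e i * v i.
    by rewrite rmorph_sum; apply: eq_bigr => i _; rewrite /= mevalZ mevalXU.
  exists (l * G); rewrite /ev !mevalM !evl -ey; split=> //; first exact: (dhomogM hl hG).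
  apply: idealMr => //; apply: Lsj.
  have -> : (\sum_i e i * c i) * s`_j = y - \sum_i e i * (s`_i - c i * s`_j).
    rewrite ey mulr_suml -sumrB; apply: eq_bigr => i _; ring.
  by apply: idealB => //; apply: (ideal_sum hL) => i _; exact: (idealMl hL).
(* The contradiction: [s_j^(r+1)] lies in [I m^r], so it is the value of a form vanishing at [c]
   modulo [m]; by freeness [X_j^(r+1)] vanishes there as well, though [c j] is outside [m]. *)
have [|F [hF eF mF]] := vanish (s`_j ^+ r.+1).
  apply: (mul_mono IL (@subset_refl _ _)); rewrite Ir.
  by apply: mem_expX; apply: sm; exact: mem_nth.
have : coef_in m ('X_j ^+ r.+1 - F).
  apply: (free (d := r.+1)); last first.
    by rewrite /ev mevalB rmorphXn /= mevalXU -/(ev F) eF subrr.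
  apply: dhomogD; last by rewrite dhomogN.
  by rewrite -[X in X.-homog for _]mul1n; apply: dhomogMn; rewrite dhomogX; apply/eqP; exact: mdeg1.
move=> /(coef_in_meval c mideal); rewrite mevalB rmorphXn /= mevalXU => h.
by apply: cj; apply: (primeX (n := r.+1) mprime); rewrite -(subrK F.@[c] (c j ^+ _)); exact: idealD.
Qed.

Hypothesis s_gt0 : (0 < size s)%N.

Let x := s`_0.
Let mx : m x. Proof. by apply: sm; exact: mem_nth. Qed.

Lemma form_free_expX_colon i d a : ideal_exp m (i + d) (a * x ^+ d) -> ideal_exp m i a.
Proof.
elim: d a => [|d ih] a; first by rewrite addn0 mulr1.
rewrite addnS exprSr mulrA => /(form_free_exp_colon fr sV ms free s_gt0); exact: ih.
Qed.

Lemma form_free_colon_m d : colon (ideal_exp m d.+1) m = ideal_exp m d.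
Proof.
apply/seteqP; split=> a.
  by move=> /(_ x mx); exact: (form_free_exp_colon fr sV ms free s_gt0).
by move=> ma b mb; rewrite mulrC; exact: mem_mul.
Qed.

Lemma form_free_colon_elt d : colon_elt (ideal_exp m d.+1) x = ideal_exp m d.
Proof.
apply/seteqP; split=> a; first exact: (form_free_exp_colon fr sV ms free s_gt0).
by move=> ma; rewrite /colon_elt /= mulrC; exact: mem_mul.
Qed.

Lemma form_free_m_not_exp2 : ~ ideal_exp m 2 x.
Proof.
move=> m2x; apply: m1; have := @form_free_exp_colon _ _ _ _ _ fr s sV ms free 1%N 0%N 1 s_gt0.
by rewrite mul1r => /(_ m2x); rewrite ideal_exp1.
Qed.

Lemma form_free_ratliff_rush i : ratliff_rush (ideal_exp m i) = ideal_exp m i.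
Proof.
apply/seteqP; split=> [a [n _ /= h]|a ma].
  (* It is enough to multiply by the single element [x^(i n)] of [(m^i)^n]. *)
  apply: (@form_free_expX_colon i (i * n)); rewrite -mulnS -ideal_expM.
  by apply: h; rewrite ideal_expM; exact: mem_expX.
by exists 1%N => // b mb; rewrite ideal_expS; exact: mem_mul.
Qed.

Lemma form_free_s_number : s_number m 1.
Proof.
split; last by move=> k [].
by split=> // i _; exact: form_free_ratliff_rush.
Qed.

Lemma form_free_dao I : reduction adm m I -> [/\ dao1 m I 0, dao2 m I 0 & dao3 m I 0].
Proof.
move=> /form_free_reduction->; split; split=> // k _; rewrite -ideal_expS.
- exists x; split=> //; first exact: form_free_m_not_exp2.
  by rewrite ideal_mulC -ideal_expS form_free_colon_elt.
- exists x; split=> //; first exact: form_free_m_not_exp2.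
  by rewrite form_free_colon_elt form_free_colon_m.
- by rewrite /weakly_m_full ideal_mulC -ideal_expS form_free_colon_m.
Qed.

Lemma form_free_reduction_number I : reduction adm m I -> reduction_number m I 0.
Proof. by move=> /form_free_reduction->; split. Qed.

End Consequences.

(** * Conditions (e) and (f) as one family of colon equations *)

Section ReesColon.
Context {R : comNzRingType}.
Variable m : set R.
Hypotheses (mideal : is_ideal m) (depth : depth_gt0 m).

Lemma component_rees I k : is_ideal I ->
  component (rees m I) (Posz k) = ideal_mul I (ideal_exp m k).
Proof.
move=> hI; apply/seteqP; split=> a /=.
  by move=> /(_ k); rewrite coefZ coefXn eqxx mulr1.
move=> ha l; rewrite coefZ coefXn; case: eqP => [->|_]; first by rewrite mulr1.
by rewrite mulr0; exact: ideal0.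
Qed.

Lemma component_poly_colon I k : is_ideal I ->
  component (poly_colon (rees_ge1 m I) m) (Posz k.+1) =
  colon (ideal_mul I (ideal_exp m k.+1)) m.
Proof.
move=> hI; apply/seteqP; split=> a /=.
  move=> h b mb; have [/(_ k.+1)] := h b mb.
  by rewrite !coefZ coefXn eqxx mulr1 mulrC.
move=> h b mb; split=> [l|]; last by rewrite !coefZ coefXn /= !mulr0.
rewrite !coefZ coefXn; case: eqP => [->|_].
  by rewrite mulr1 mulrC; exact: h.
by rewrite !mulr0; exact: ideal0.
Qed.

Lemma component_poly_colon0 I : is_ideal I ->
  component (poly_colon (rees_ge1 m I) m) 0 = [set 0].
Proof.
move=> hI; apply/seteqP; split=> a /=; last first.
  move=> -> b mb; rewrite scale0r scaler0; split=> [l|]; last by rewrite coef0.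
  by rewrite coef0; exact: ideal0.
move=> h; have [b mb] := depth; apply.
by have [_] := h b mb; rewrite !coefZ coefXn mulr1.
Qed.

(** Degree [k >= 0] is the colon equation, degree [-1] reads [0 : m = 0], which is the assumption on
    depth, and below that both sides are 0. *)
Lemma rees_colon_eqP I : is_ideal I -> rees_colon_eq m I <->
  forall k, colon (ideal_mul I (ideal_exp m k.+1)) m = ideal_mul I (ideal_exp m k).
Proof.
move=> hI; split=> [h k|h [k|[|k]]].
- by rewrite -component_poly_colon // -component_rees // (h (Posz k)) -PoszD addn1.
- by rewrite -PoszD addn1 component_rees // component_poly_colon.
- by rewrite component_poly_colon0.
- by [].
Qed.

Lemma dao3_eq0P I : is_ideal I -> dao3 m I 0 <->
  forall k, colon (ideal_mul I (ideal_exp m k.+1)) m = ideal_mul I (ideal_exp m k).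
Proof.
move=> hI.
have e k : ideal_mul I (ideal_exp m k.+1) = ideal_mul (ideal_mul I (ideal_exp m k)) m.
  by rewrite -ideal_mulA // (ideal_mulC _ m).
split=> [[h _] k|h]; first by rewrite e; exact: h.
by split=> // k _; rewrite /weakly_m_full -e.
Qed.

(* Descending from I m^r = m^(r+1) by taking colons with m. *)
Lemma weakly_full_reduction adm I : reduction adm m I -> is_ideal I ->
  (forall k, colon (ideal_mul I (ideal_exp m k.+1)) m = ideal_mul I (ideal_exp m k)) ->
  I = m.
Proof.
move=> [_ Im [r Ir]] hI h; apply/seteqP; split=> //.
suff : ideal_exp m 1 `<=` ideal_mul I (ideal_exp m 0) by rewrite ideal_exp1 // ideal_mulr1.
have : ideal_exp m r.+1 `<=` ideal_mul I (ideal_exp m r) by rewrite Ir.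
elim: r {Ir} => // r ih hr; apply: ih; rewrite -h => a ma b mb; apply: hr.
by rewrite mulrC; exact: mem_mul.
Qed.

End ReesColon.

(** * Linear forms, and the linear type of ideals generated by [d]-sequences *)

Section LinearForms.
Context {R : comNzRingType}.
Implicit Types (m : set R) (s x : seq R).

Lemma linear_formE n (l : {mpoly R[n]}) : l \is 1.-homog for mdeg ->
  l = \sum_i l@_U_(i) *: 'X_i.
Proof.
move=> hl; apply/mpolyP => k; rewrite raddf_sum /=.
have [/mdeg1P[i /eqP->]|k1] := boolP (mdeg k == 1%N).
  rewrite (bigD1 i) //= mcoeffZ mcoeffXU eqxx mulr1 big1 ?addr0 // => j ji.
  by rewrite mcoeffZ mcoeffXU (negbTE ji) mulr0.
rewrite (dhomog_nemf_coeff hl) // big1 // => i _; rewrite mcoeffZ mcoeffX.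
by case: eqP => [e|_]; [rewrite -e mdeg1 in k1|rewrite mulr0].
Qed.

Lemma dhomog_comp n k (F : {mpoly R[n]}) (t : n.-tuple {mpoly R[k]}) d :
  (forall i, tnth t i \is 1.-homog for mdeg) -> F \is d.-homog for mdeg ->
  F \mPo t \is d.-homog for mdeg.
Proof.
move=> ht /dhomogP hF; rewrite comp_mpolyEX big_seq_cond; apply: rpred_sum => l.
move=> /andP[/hF <- _]; apply: dhomogZ; rewrite comp_mpolyX /= mdegE.
elim/big_ind2: _ => [|a b c e|i _]; [exact: dhomog1|exact: dhomogM|].
by have := dhomogMn (l i) (ht i); rewrite mul1n.
Qed.

Lemma comp_congr n k (F : {mpoly R[n]}) (t u : n.-tuple {mpoly R[k]})
    (M : set {mpoly R[k]}) : is_ideal M -> (forall i, M (tnth t i - tnth u i)) ->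
  M ((F \mPo t) - (F \mPo u)).
Proof.
move=> hM htu; rewrite !comp_mpolyEX -sumrB; apply: (ideal_sum hM) => l _.
rewrite -scalerBr -mul_mpolyC; apply: (idealMl hM); rewrite !comp_mpolyX.
have MM a b c e : M (a - b) -> M (c - e) -> M (a * c - b * e).
  move=> hab hce; have -> : a * c - b * e = c * (a - b) + b * (c - e) by ring.
  by apply: (idealD hM); exact: (idealMl hM).
have M1 : M (1 - 1) by rewrite subrr; exact: (ideal0 hM).
elim/big_ind2: _ => [//|a b c e|i _]; first exact: MM.
by elim: (l i) => // e ih; rewrite !exprS; exact: MM.
Qed.

Lemma form_of_gens s x : [set` x] `<=` ideal_gen [set` s] ->
  exists t : (size x).-tuple {mpoly R[size s]},
    (forall i, tnth t i \is 1.-homog for mdeg) /\ forall i, ev (tnth t i) = x`_i.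
Proof.
move=> xs; have /choice[f hf] : forall i : 'I_(size x), exists F : {mpoly R[size s]},
    F \is 1.-homog for mdeg /\ ev F = x`_i.
  move=> i; have [|F hF eF] := @exp_ev R s 1 x`_i; last by exists F.
  by rewrite ideal_exp1 //; apply: xs; exact: mem_nth.
exists [tuple f i | i < size x].
by split=> i; rewrite tnth_mktuple; [exact: (hf i).1|exact: (hf i).2].
Qed.

Lemma ev_comp s x (t : (size x).-tuple {mpoly R[size s]}) F :
  (forall i, ev (tnth t i) = x`_i) -> ev (F \mPo t) = ev F.
Proof. by move=> ht; rewrite /ev comp_mpoly_meval; exact: meval_eq. Qed.

End LinearForms.

Section LinearType.
Context {R : comNzRingType}.
Variable s : seq R.

Let n := size s.
Let L i := ideal_gen [set` take i s].

Let idealL i : is_ideal (L i). Proof. exact: ideal_genP. Qed.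

(** [F] lies in the ideal of the linear forms whose value at [s] is in [L i]. The list keeps all
    cofactors homogeneous of degree [d], as the induction on the degree requires. *)
Let linear_type i d (F : {mpoly R[n]}) := exists2 l : seq ({mpoly R[n]} * {mpoly R[n]}),
  forall p, p \in l -> [/\ p.1 \is d.-homog for mdeg, p.2 \is 1.-homog for mdeg & L i (ev p.2)]
  & F = \sum_(p <- l) p.1 * p.2.

Let linear_type0 i d : linear_type i d 0.
Proof. by exists [::]; rewrite // big_nil. Qed.

Let linear_typeD i d F G : linear_type i d F -> linear_type i d G -> linear_type i d (F + G).
Proof.
move=> [l hl ->] [k hk ->]; exists (l ++ k); last by rewrite big_cat.
by move=> p; rewrite mem_cat => /orP[/hl|/hk].
Qed.

Let linear_type1 i d G l : G \is d.-homog for mdeg -> l \is 1.-homog for mdeg ->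
  L i (ev l) -> linear_type i d (G * l).
Proof.
move=> hG hl Ll; exists [:: (G, l)]; last by rewrite big_seq1.
by move=> p; rewrite inE => /eqP->.
Qed.

Let linear_typeM i d e F G : G \is e.-homog for mdeg -> linear_type i d F ->
  linear_type i (e + d) (G * F).
Proof.
move=> hG [l hl ->]; rewrite mulr_sumr big_seq_cond.
elim/big_ind: _ => [||p /andP[/hl[p1 p2 p3] _]]; first exact: linear_type0.
  exact: linear_typeD.
by rewrite mulrA; apply: linear_type1 => //; exact: dhomogM.
Qed.

Hypothesis ds : d_sequence s.

Let d_colon i j a : (i <= j < n)%N -> L i (a * (s`_i * s`_j)) <-> L i (a * s`_j).
Proof. by move=> ij; have [_ /(_ i j ij) e] := ds; rewrite -![L i _]/(colon_elt _ _ a) e. Qed.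

(* If b kills s_i modulo (s_0, ..., s_(i-1)), it also kills every later s_k, and
   then it can be pushed down the filtration of m by the (s_0, ..., s_(k-1)). *)
Let d_sequence_colon i b : (i < n)%N -> ideal_gen [set` s] b -> L i (b * s`_i) -> L i b.
Proof.
move=> si mb bi.
have Lmono k : L k `<=` L k.+1.
  by apply: gen_mono => a; rewrite /= -[take k s](take_takel s (leqnSn k)); exact: mem_take.
have Lle k : (i <= k)%N -> L i `<=` L k.
  move/subnK <-; elim: (k - i)%N => // j ih.
  by rewrite addSn; apply: subset_trans ih (Lmono _).
have bk k : (i <= k < n)%N -> L i (b * s`_k).
  move=> ik; rewrite -d_colon //; have -> : b * (s`_i * s`_k) = s`_k * (b * s`_i) by ring.
  exact: (idealMl (idealL i)).
suff h e : (e <= n - i)%N -> L (n - e)%N b.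
  by have := h (n - i)%N (leqnn _); rewrite subKn // ltnW.
elim: e => [_|e ih ei]; first by rewrite subn0 /L take_size.
have ein : (e < n)%N := leq_trans ei (leq_subr _ _).
have kS : (n - e)%N = (n - e.+1).+1 by rewrite subnSK.
have ik : (i <= n - e.+1)%N by rewrite leq_subRL ?(ltnW si) // addnC -leq_subRL // ltnW.
have kn : (n - e.+1 < n)%N by rewrite -kS leq_subr.
have := ih (ltnW ei); rewrite kS /L gen_take_S // -/(L _).
move: (n - e.+1)%N ik kn => k ik kn [l Ll [_ [c _ <-] eb]].
rewrite -/(L k) -eb; apply: (idealD (idealL k)) => //.
(* The diagonal case of the [d]-sequence condition: [c * s_k^2] in [L k] gives [c * s_k] in
   [L k]. *)
apply/(@d_colon k k) => //; rewrite ?leqnn //.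
have -> : c * (s`_k * s`_k) = b * s`_k - l * s`_k by rewrite -eb; ring.
apply: (idealB (idealL k)); last exact: (idealMr (idealL k)).
by apply: Lle => //; apply: bk; rewrite ik.
Qed.

(* Every form vanishing at s modulo (s_0, ..., s_(i-1)) is a combination of linear
   ones; for i = 0 this says that the symmetric and Rees algebras agree. *)
Let d_sequence_linear i d (F : {mpoly R[n]}) : (i <= n)%N ->
  F \is d.+1.-homog for mdeg -> L i (ev F) -> linear_type i d F.
Proof.
move=> /subKn; move: (n - i)%N => j; elim: j i d F => [|j ih] i d F.
  rewrite subn0 => <- /dhomogP hF _; rewrite [F]mpolyE big_seq_cond.
  elim/big_ind: _ => [||k /andP[/hF /= dk _]]; first exact: linear_type0.
    exact: linear_typeD.
  have [l kl] : exists l, k l != 0%N.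
    apply/existsP; rewrite -negb_forall; apply/negP => /forallP k0.
    by move: dk; rewrite mdegE big1 // => l _; exact/eqP/k0.
  have -> : 'X_[k] = 'X_[k - U_(l)] * 'X_l :> {mpoly R[n]}.
    by rewrite -mpolyXD submK // lep1mP.
  rewrite scalerAl; apply: linear_type1.
  - apply: dhomogZ; rewrite dhomogX /=; apply/eqP; apply: succn_inj.
    by rewrite -dk -[in RHS](submK (m := U_(l)%MM) (m' := k)) ?lep1mP // mdegD mdeg1 addn1.
  - by rewrite dhomogX; apply/eqP; exact: mdeg1.
  - by rewrite /ev mevalXU /L take_size; exact: mem_gen_nth.
(* For [j >= n] the truncated differences [n - j] and [n - j.+1] are both 0, and the induction
   hypothesis applies as it is. *)
case: (ltnP j n) => [jn ei|nj]; last first.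
  move=> ei; apply: (ih i d F); rewrite -ei subnS.
  by have /eqP-> : (n - j == 0)%N by rewrite subn_eq0.
have si : (i < n)%N by rewrite -ei ltn_subrL /= (leq_ltn_trans _ jn).
have eSi : (n - j)%N = i.+1 by rewrite -ei subnSK.
pose oi : 'I_n := Ordinal si.
elim: d F => [|d ihd] F hF LF.
  by rewrite -[F]mul1r; apply: linear_type1 => //; exact: dhomog1.
have LiS : L i.+1 (ev F).
  by rewrite /L gen_take_S //; exact: (add_subl (ideal_multiples _)).
have [l hl eF] := ih _ _ _ eSi hF LiS.
(* A linear form with value in [L i.+1] is corrected by a multiple of [X_i] into one with value in
   [L i]; [H] collects the corrections. *)
have /choice[c hc] : forall p : {mpoly R[n]} * {mpoly R[n]}, exists c,
    L i.+1 (ev p.2) -> L i (ev p.2 + c * s`_i).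
  move=> p; case: (pselect (L i.+1 (ev p.2))) => [|h]; last by exists 0.
  rewrite /L gen_take_S // => -[l0 Ll0 [_ [r _ <-] e]]; exists (- r) => _.
  by rewrite -e; have -> : l0 + r * s`_i + - r * s`_i = l0 by ring.
pose H := \sum_(p <- l) c p *: p.1.
have hH : H \is d.+1.-homog for mdeg.
  rewrite /H big_seq_cond; apply: rpred_sum => p /andP[/hl[p1 _ _] _].
  exact: dhomogZ.
have hX : ('X_oi : {mpoly R[n]}) \is 1.-homog for mdeg.
  by rewrite dhomogX; apply/eqP; exact: mdeg1.
have lt1 : linear_type i d.+1 (F + 'X_oi * H).
  rewrite eF /H mulr_sumr -big_split /= big_seq_cond.
  elim/big_ind: _ => [||p /andP[/hl[p1 p2 p3] _]]; first exact: linear_type0.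
    exact: linear_typeD.
  have -> : p.1 * p.2 + 'X_oi * (c p *: p.1) = p.1 * (p.2 + c p *: 'X_oi).
    by rewrite mulrDr -!scalerAr (mulrC p.1 'X_oi).
  apply: linear_type1 => //; first by apply: dhomogD => //; exact: dhomogZ.
  by rewrite /ev mevalD mevalZ mevalXU; exact: hc.
have mH : ideal_gen [set` s] (ev H).
  have := @ev_exp R s (ideal_gen [set` s]) H d.+1 (ideal_genP _).
  by move=> /(_ (@sub_gen _ _) hH); apply: mul_subl.
(* [H(s) * s_i] is a difference of two values in [L i], so [H] takes a value in [L i] too; having
   smaller degree than [F], it falls under the inner induction. *)
have LH : L i (ev H).
  apply: d_sequence_colon => //.
  have -> : ev H * s`_i = ev (F + 'X_oi * H) - ev F.
    by rewrite /ev mevalD mevalM mevalXU /=; ring.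
  apply: (idealB (idealL i)) => //.
  have [k hk ->] := lt1; rewrite /ev rmorph_sum big_seq_cond.
  apply: (ideal_sum (idealL i)) => p /andP[/hk[_ _ Lp] _].
  by rewrite /= mevalM; exact: (idealMl (idealL i)).
have -> : F = (F + 'X_oi * H) + (- 'X_oi) * H by ring.
apply: linear_typeD => //; rewrite -add1n; apply: linear_typeM; last exact: ihd.
by rewrite dhomogN.
Qed.

(** Change of generators by linear substitutions, [t] from [x] to [s] and [u] back. Linear type
    splits [F] after [t] into multiples of linear forms vanishing at [s]; after [u] these vanish at
    [x], so have coefficients in [m]. Going back and forth changes [F] only modulo [m], since each
    [t_i] after [u] minus [X_i] is linear and vanishes at [x]. *)
Lemma d_sequence_form_free m x : is_ideal m -> m = ideal_gen [set` s] ->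
  m = ideal_gen [set` x] ->
  (forall c : 'I_(size x) -> R, \sum_i c i * x`_i = 0 -> forall i, m (c i)) ->
  form_free m x.
Proof.
move=> hm ms mx xind [|d] F hF F0.
  move: F0; rewrite /ev (dhomog0_const hF) mevalC => -> k.
  by rewrite mpolyC0 mcoeff0; exact: ideal0.
have lin_m (l : {mpoly R[size x]}) : l \is 1.-homog for mdeg -> ev l = 0 -> coef_in m l.
  move=> hl l0; rewrite (linear_formE hl).
  have hc := ideal_coef_in (n := size x) hm; apply: (ideal_sum hc) => i _.
  apply: coef_inZX => //; apply: (xind (fun i => l@_U_(i))).
  rewrite -[RHS]l0 [in RHS](linear_formE hl) /ev rmorph_sum.
  by apply: eq_bigr => j _; rewrite /= mevalZ mevalXU.
have [|t [ht et]] := @form_of_gens _ s x; first by rewrite -ms mx; exact: sub_gen.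
have [|u [hu eu]] := @form_of_gens _ x s; first by rewrite -mx ms; exact: sub_gen.
have hC := ideal_coef_in (n := size x) hm.
have [l hl eF] : linear_type 0 d (F \mPo t).
  apply: d_sequence_linear => //; first exact: dhomog_comp.
  by rewrite (ev_comp _ et) F0; exact: (ideal0 (idealL 0)).
have L0 a : L 0 a -> a = 0.
  by apply: (@gen_sub _ _ [set 0] ideal_zero) => b; rewrite /= take0.
have mFtu : coef_in m ((F \mPo t) \mPo u).
  rewrite eF raddf_sum big_seq_cond; apply: (ideal_sum hC) => p /andP[/hl[_ p2 /L0 p0] _].
  rewrite /= rmorphM; apply: (idealMl hC); apply: lin_m; first exact: dhomog_comp.
  by rewrite (ev_comp _ eu).
have := @comp_congr _ _ _ F [tuple tnth t i \mPo u | i < size x] [tuple 'X_i | i < size x]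
  (coef_in m) hC.
rewrite comp_mpoly_id.
have -> : F \mPo [tuple tnth t i \mPo u | i < size x] = (F \mPo t) \mPo u.
  rewrite (comp_mpolyEX F t) raddf_sum [LHS]comp_mpolyEX; apply: eq_bigr => k _.
  rewrite /= comp_mpolyZ !comp_mpolyX rmorph_prod; congr (_ *: _).
  by apply: eq_bigr => i _; rewrite /= rmorphXn tnth_mktuple.
move=> h; rewrite -(opprK F) -[- F](addKr ((F \mPo t) \mPo u)) opprD opprK.
apply: (idealB hC) => //; apply: h => i; rewrite !tnth_mktuple; apply: lin_m.
  apply: dhomogD; first exact: dhomog_comp.
  by rewrite dhomogN dhomogX; apply/eqP; exact: mdeg1.
by rewrite /ev mevalB mevalXU -/(ev _) (ev_comp _ eu) et subrr.
Qed.

End LinearType.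

(** * Local rings and standard graded algebras are frames *)

Section Frames.
Context {R : comNzRingType}.
Variable m : set R.
Hypothesis hR : noetherian R.

Lemma exists_maximal (I : set R) : is_ideal I -> ~ I 1 ->
  exists2 n, maximal_ideal n & I `<=` n.
Proof.
move=> hI I1.
have [|n [[hn n1] In nmax]] := @noetherian_max _ hR [set J | is_ideal J /\ ~ J 1] I _ (conj hI I1).
  by move=> J [].
by exists n => //; split=> // J hJ nJ J1; apply: nmax.
Qed.

(** Finitely many generators can be chosen inside [A]; for [G 1] this gives linear generators of
    [m]. *)
Lemma noetherian_gen_seq (A : set R) :
  exists2 s : seq R, [set` s] `<=` A & ideal_gen A = ideal_gen [set` s].
Proof.
have [||_ [[s sA ->] _ smax]] := @noetherian_max _ hR
  [set J | exists2 s : seq R, [set` s] `<=` A & J = ideal_gen [set` s]] (ideal_gen [set` [::]]).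
- by move=> _ [s _ ->]; exact: ideal_genP.
- by exists [::].
exists s => //; apply/seteqP; split; last exact: gen_mono.
apply: gen_sub => // a Aa; rewrite -(smax (ideal_gen [set` a :: s])).
- by apply: sub_gen; rewrite /= mem_head.
- by exists (a :: s) => // b; rewrite /= inE => /orP[/eqP->|/sA].
- by apply: gen_mono => b /= bs; rewrite inE bs orbT.
Qed.

Lemma local_frame : unique_maximal is_ideal m -> infinite_set (residue_classes m) ->
  frame m is_ideal m setT.
Proof.
move=> [hm mm uniq] inf; split=> //.
(* Saturation: an element outside the only maximal ideal is a unit. *)
- move=> I hI u a mu Iua.
  suff [r ru] : multiples u 1.
    by move=> e; rewrite -(mul1r a) -e -mulrA; exact: idealMl.
  apply: contrapT => u1; have [n mn un] := exists_maximal (ideal_multiples u) u1.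
  have hn : is_ideal n by case: mn.
  by apply: mu; rewrite -(uniq n hn mn); apply: un; exact: mem_multiples.
- exact: ideal_addP.
- exact: ideal0.
- by move=> a b; exact: idealB.
- by move=> c a _; exact: idealMl.
- by move=> r; exists r => //; rewrite subrr; exact: ideal0.
- move=> t; apply: contrapT => h; apply: inf.
  apply: (@sub_finite_set _ _ [set [set b | m (b - a)] | a in [set` t]]); last first.
    exact/finite_image/finite_seq.
  move=> _ [c _ <-]; have [a ta ca] : exists2 a, a \in t & m (c - a).
    apply: contrapT => h'; apply: h; exists c => // a ta mca.
    by apply: h'; exists a.
  exists a => //; apply/seteqP; split=> b /= mb.
    have -> : b - c = (b - a) - (c - a) by ring.
    exact: idealB.
  have -> : b - a = (b - c) + (c - a) by ring.
  exact: idealD.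
- have [s es] := hR hm; exists s => //; rewrite es; exact: sub_gen.
Qed.

Section GradedFrame.
Context {K : fieldType} {iota : {rmorphism K -> R}} {G : nat -> set R}.
Hypothesis sg : standard_graded iota G.

Let G0 i : G i 0. Proof. by case: sg => /(_ i)[]. Qed.

Let GD i a b : G i a -> G i b -> G i (a + b).
Proof. by case: sg => /(_ i)[_ + _] _ _ _ _; apply. Qed.

Let GZ i k a : G i a -> G i (iota k * a).
Proof. by case: sg => /(_ i)[_ _ +] _ _ _ _; apply. Qed.

Let GB i a b : G i a -> G i b -> G i (a - b).
Proof. by move=> Ga Gb; apply: GD => //; rewrite -mulN1r -(rmorphN1 iota); exact: GZ. Qed.

Let GM i j a b : G i a -> G j b -> G (i + j)%N (a * b).
Proof. by case: sg => _ _ _ + _; apply. Qed.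

(** Decompositions are indexed by all degrees and vanish eventually, so that those of different
    lengths can be added and compared. *)
Definition components (a : R) (c : nat -> R) : Prop :=
  (forall i, G i (c i)) /\
  exists N, (forall i, (N <= i)%N -> c i = 0) /\ a = \sum_(i < N) c i.

Let components_widen a c N : components a c -> exists2 M, (N <= M)%N &
  (forall i, (M <= i)%N -> c i = 0) /\ a = \sum_(i < M) c i.
Proof.
move=> [_ [N' [c0 ->]]]; exists (maxn N' N); first exact: leq_maxr.
split=> [i|]; first by rewrite geq_max => /andP[/c0].
rewrite (big_ord_widen _ (fun i => c i) (leq_maxl N' N)) [RHS](bigID (fun i : 'I__ => (i < N')%N)) /=.
by rewrite [X in _ + X]big1 ?addr0 // => i; rewrite -leqNgt => /c0.
Qed.

Let componentsP a : exists c, components a c.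
Proof.
case: sg => _ /(_ a)[N [c [Gc ->]]] _ _ _.
exists (fun i => if (i < N)%N then c i else 0); split=> [i|]; first by case: ifP.
exists N; split=> [i|]; first by rewrite leqNgt => /negbTE->.
by apply: eq_bigr => i _; rewrite ltn_ord.
Qed.

Let componentsD a b c d : components a c -> components b d ->
  components (a + b) (fun i => c i + d i).
Proof.
move=> hc hd; split=> [i|]; first by apply: GD; [exact: hc.1|exact: hd.1].
have [_ [N [_ _]]] := hd.
have [M NM [c0 ea]] := components_widen N hc.
have [M' MM' [d0 eb]] := components_widen M hd.
have [M2 MM2 [c02 ea2]] := components_widen M' hc.
exists M2; split=> [i Mi|]; first by rewrite c02 // d0 ?addr0 // (leq_trans MM2).
rewrite big_split -ea2 /=; congr (_ + _); rewrite eb.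
rewrite (big_ord_widen _ (fun i => d i) MM2) [RHS](bigID (fun i : 'I__ => (i < M')%N)) /=.
by rewrite [X in _ + X]big1 ?addr0 // => i; rewrite -leqNgt => /d0.
Qed.

Let components0 : components 0 (fun=> 0).
Proof. by split=> //; exists 0%N; split=> //; rewrite big_ord0. Qed.

Let components_uniq a c d : components a c -> components a d -> c =1 d.
Proof.
move=> hc hd i.
have hZ : components (-1 * a) (fun j => -1 * d j).
  have [Gd [N [d0 ea]]] := hd; split=> [j|].
    by rewrite -(rmorphN1 iota); exact: GZ.
  exists N; split=> [j /d0->|]; first by rewrite mulr0.
  by rewrite ea mulr_sumr.
have hcd := componentsD hc hZ; have [M iM [z0 ez]] := components_widen i.+1 hcd.
case: sg => _ _ /(_ M _ hcd.1) h _ _; apply/eqP; rewrite -subr_eq0 -mulN1r; apply/eqP.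
apply: h iM; rewrite -ez; ring.
Qed.

Let components_homog i g : G i g -> components g (fun j => if j == i then g else 0).
Proof.
move=> Gg; split=> [j|]; first by case: eqP => [->|].
exists i.+1; split=> [j ij|]; first by rewrite gtn_eqF.
by rewrite big_ord_recr /= eqxx big1 ?add0r // => j _; rewrite ltn_eqF.
Qed.

Let componentsM i g a c : G i g -> components a c ->
  components (g * a) (fun j => if (i <= j)%N then g * c (j - i)%N else 0).
Proof.
move=> Gg [Gc [N [c0 ->]]]; split=> [j|].
  by case: ifP => // ij; rewrite -{1}(subnKC ij); exact: GM.
exists (i + N)%N; split=> [j|].
  move=> iNj; have ij : (i <= j)%N := leq_trans (leq_addr _ _) iNj.
  by rewrite ij c0 ?mulr0 // leq_subRL.
rewrite big_split_ord /= [X in _ = X + _]big1 ?add0r => [|j _]; last by rewrite leqNgt ltn_ord.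
by rewrite mulr_sumr; apply: eq_bigr => j _; rewrite leq_addr addKn.
Qed.

Let components_sum N (a : nat -> R) (c : nat -> nat -> R) :
  (forall p, components (a p) (c p)) ->
  components (\sum_(p < N) a p) (fun i => \sum_(p < N) c p i).
Proof.
move=> h; elim: N => [|N ih].
  by rewrite big_ord0 (_ : (fun i => _) = fun=> 0) //; apply/funext => i; rewrite big_ord0.
rewrite big_ord_recr (_ : (fun i => _) = fun i => \sum_(p < N) c p i + c N i) /=.
  exact: componentsD.
by apply/funext => i; rewrite big_ord_recr.
Qed.

Let components_mul (u a : R) (d c : nat -> R) N :
  (forall i, G i (d i)) -> u = \sum_(p < N) d p -> components a c ->
  components (u * a) (fun i => \sum_(p < N) if (p <= i)%N then d p * c (i - p)%N else 0).
Proof.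
move=> Gd -> hc; rewrite mulr_suml.
apply: (@components_sum N (fun p => d p * a)
  (fun p i => if (p <= i)%N then d p * c (i - p)%N else 0)) => p.
exact: componentsM.
Qed.

Lemma homogeneous_gen (A : set R) : A `<=` \bigcup_i G i -> homogeneous_ideal G (ideal_gen A).
Proof.
move=> AG; split; first exact: ideal_genP.
apply/seteqP; split; last by apply: gen_sub => // a [].
by apply: gen_mono => a Aa; split; [exact: sub_gen|exact: AG].
Qed.

Let homogeneous_components H a c :
  homogeneous_ideal G H -> H a -> components a c -> forall i, H (c i).
Proof.
move=> [hH eH] Ha hc.
suff [d hd Hd] : exists2 d, components a d & forall i, H (d i).
  by move=> i; rewrite (components_uniq hc hd).
pose S := [set b | exists2 d, components b d & forall i, H (d i)].
suff : ideal_gen (H `&` \bigcup_i G i) `<=` S by apply; rewrite -eH.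
apply: gen_sub; last first.
  move=> g [Hg [i _ Gg]]; exists (fun j => if j == i then g else 0).
    exact: components_homog.
  by move=> j; case: ifP => // _; exact: ideal0.
split; first by exists (fun=> 0) => // _; exact: ideal0.
  move=> x y [d hd Hd] [e he He]; exists (fun i => d i + e i); first exact: componentsD.
  by move=> i; exact: idealD.
move=> r x [d hd Hd]; have [e [Ge [N [_ er]]]] := componentsP r.
exists (fun i => \sum_(p < N) if (p <= i)%N then e p * d (i - p)%N else 0).
  exact: components_mul.
move=> i; apply: (ideal_sum hH) => p _; case: ifP => _; last exact: ideal0.
exact: idealMl.
Qed.

Let M := ideal_gen (G 1%N).

Let M_components a : M a -> exists2 c, components a c & c 0%N = 0.
Proof.
apply: (@gen_sub _ _ [set a | exists2 c, components a c & c 0%N = 0]); last first.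
  by move=> g Gg; exists (fun j => if j == 1%N then g else 0) => //; exact: components_homog.
split; first by exists (fun=> 0).
  move=> x y [d hd d0] [e he e0]; exists (fun i => d i + e i); first exact: componentsD.
  by rewrite d0 e0 addr0.
move=> r x [d hd d0]; have [e [Ge [N [_ er]]]] := componentsP r.
exists (fun i => \sum_(p < N) if (p <= i)%N then e p * d (i - p)%N else 0).
  exact: components_mul.
by apply: big1 => p _; case: ifP => //; rewrite leqn0 => /eqP->; rewrite subn0 d0 mulr0.
Qed.

Let G_iota k : G 0%N (iota k).
Proof. by case: sg => _ _ _ _ [-> _]; exists k. Qed.

Let M1 : ~ M 1.
Proof.
move=> /M_components[c hc c0]; have := components_homog (G_iota 1).
rewrite rmorph1 => /components_uniq/(_ hc)/(_ 0%N)/eqP; rewrite /= c0.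
by rewrite oner_eq0.
Qed.

(** Sums of a constant and an element of [M] form a subalgebra containing [G 1]. *)
Let M_decomp a : exists k b, M b /\ a = iota k + b.
Proof.
have : [set: R] a by [].
have [_ _ _ _ [_ <-]] := sg.
apply: (@smallest_sub _ _ (G 1%N) [set a | exists k b, M b /\ a = iota k + b]).
  have hM : is_ideal M by exact: ideal_genP.
  split=> [k|x y [k [b [Mb ->]]] [l [d [Md ->]]]|x y [k [b [Mb ->]]] [l [d [Md ->]]]].
  - by exists k, 0; split; [exact: (ideal0 hM)|rewrite addr0].
  - exists (k + l), (b + d); split; first exact: (idealD hM).
    by rewrite rmorphD; ring.
  - exists (k * l), (iota k * d + (iota l + d) * b); split.
      by apply: (idealD hM); exact: (idealMl hM).
    by rewrite rmorphM /=; ring.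
by move=> g Gg; exists 0, g; rewrite rmorph0 add0r; split=> //; exact: sub_gen.
Qed.

Let iota_unit (I : set R) k : is_ideal I -> k != 0 -> I (iota k) -> I 1.
Proof.
move=> hI k0 Ik; rewrite -(rmorph1 iota) -(mulVf k0) rmorphM.
exact: idealMl.
Qed.

Let M_maximal : maximal_ideal M.
Proof.
split=> //; first exact: ideal_genP.
move=> J hJ MJ J1; apply/seteqP; split=> // a Ja.
have [k [b [Mb ea]]] := M_decomp a.
have [k0|k0] := eqVneq k 0; first by rewrite ea k0 rmorph0 add0r.
case: J1; apply: (iota_unit hJ k0).
have -> : iota k = a - b by rewrite ea; ring.
by apply: idealB => //; exact: MJ.
Qed.

Hypothesis um : unique_maximal (homogeneous_ideal G) m.

Lemma graded_maximal : m = ideal_gen (G 1%N).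
Proof.
case: um => _ _ /(_ M) <- //; apply: homogeneous_gen => a Ga; by exists 1%N.
Qed.

Lemma graded_iota k : m (iota k) -> k = 0.
Proof.
move=> mk; apply/eqP/negPn/negP => k0; apply: M1.
by rewrite graded_maximal in mk; exact: iota_unit mk.
Qed.

(** Elements of [m^2] have no components in degrees 0 and 1. This turns congruences between linear
    forms modulo [m^2] into equalities. *)
Lemma graded_mul_m_degree1 a : G 1%N a -> ideal_mul m m a -> a = 0.
Proof.
move=> Ga; rewrite graded_maximal => ma.
suff [c hc c1] : exists2 c, components a c & forall i, (i <= 1)%N -> c i = 0.
  by have /(_ 1%N) := components_uniq hc (components_homog Ga); rewrite eqxx c1.
move: ma; apply: (@mul_sub _ _ _ [set a | exists2 c, components a c
    & forall i, (i <= 1)%N -> c i = 0]).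
  split; first by exists (fun=> 0).
    move=> x y [d hd d0] [e he e0]; exists (fun i => d i + e i); first exact: componentsD.
    by move=> i i1; rewrite d0 // e0 // addr0.
  move=> r x [d hd d0]; have [e [Ge [N [_ er]]]] := componentsP r.
  exists (fun i => \sum_(p < N) if (p <= i)%N then e p * d (i - p)%N else 0).
    exact: components_mul.
  move=> i i1; apply: big1 => p _; case: ifP => // pi.
  by rewrite d0 ?mulr0 // (leq_trans (leq_subr _ _)).
move=> x y /M_components[d [Gd [N [dN ex]]] d0] /M_components[e he e0].
exists (fun i => \sum_(p < N) if (p <= i)%N then d p * e (i - p)%N else 0).
  exact: components_mul.
move=> i i1; apply: big1 => p _; case: ifP => // pi.
case: (posnP p) => [->|p0]; first by rewrite d0 mul0r.
by have /eqP-> : (i - p == 0)%N; [rewrite subn_eq0 (leq_trans i1)|rewrite e0 mulr0].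
Qed.

Lemma graded_subalgebra (A : set R) : is_subalgebra iota A -> G 1%N `<=` A -> forall a, A a.
Proof.
move=> hA GA a; have : [set: R] a by [].
by have [_ _ _ _ [_ <-]] := sg; apply: smallest_sub.
Qed.

Lemma graded_sum_eq0 N (c : nat -> R) : (forall i, G i (c i)) ->
  \sum_(i < N) c i = 0 -> forall i, (i < N)%N -> c i = 0.
Proof. by case: sg => _ _ + _ _; apply. Qed.

Lemma graded_mul i j a b : G i a -> G j b -> G (i + j)%N (a * b).
Proof. exact: GM. Qed.

Lemma graded_frame : infinite_set [set: K] -> frame m (homogeneous_ideal G) (G 1%N) (range iota).
Proof.
move=> inf; have [am mm uniq] := um.
split=> //.
- by move=> I [].
- move=> H aH u a mu Hua; have hH := aH.1.
  have [k [b [Mb eu]]] := M_decomp u.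
  have k0 : k != 0.
    by apply/eqP => k0; apply: mu; rewrite eu k0 rmorph0 add0r graded_maximal.
  have [c hc] := componentsP a; have [d hd d0] := M_components Mb.
  have [e [he e0]] : exists e, components u e /\ e 0%N = iota k.
    exists (fun j => (if j == 0%N then iota k else 0) + d j); split.
      by rewrite eu; apply: componentsD => //; exact: components_homog.
    by rewrite /= d0 addr0.
  have [N N0 [_ euN]] := components_widen 1 he.
  have hua := components_mul he.1 euN hc.
  (* In degree [i] of [u * a] the constant term of [u] contributes [iota k * c i]; the other terms
     involve components of [a] of lower degree, in [H] by induction. *)
  have Hc i : H (c i).
    elim/ltn_ind: i => i ih.
    have := homogeneous_components aH Hua hua i.
    rewrite -(prednK N0) big_ord_recl /= subn0 e0 => h.
    have : H (iota k * c i).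
      apply: (idealDr hH _ h); apply: (ideal_sum hH) => p _; case: ifP => pi; last exact: ideal0.
      apply: idealMl => //; apply: ih; rewrite /bump leq0n add1n in pi *.
      by rewrite ltn_subrL /= (leq_trans _ pi).
    move=> hk; rewrite -(mul1r (c i)) -(rmorph1 iota) -(mulVf k0) rmorphM -mulrA.
    exact: idealMl.
  have [_ [n [_ ->]]] := hc; exact: (ideal_sum hH).
- rewrite (_ : setT = ideal_gen [set 1]); last first.
    by rewrite (ideal_1 (ideal_genP _)) //; exact: sub_gen.
  apply: homogeneous_gen => _ ->; exists 0%N => //; rewrite -(rmorph1 iota); exact: G_iota.
- move=> I J [hI eI] [hJ eJ].
  rewrite (_ : ideal_mul I J =
      ideal_gen [set a * b | a in I `&` \bigcup_i G i & b in J `&` \bigcup_i G i]).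
    apply: homogeneous_gen => _ [a [_ [i _ Ga]] [b [_ [j _ Gb]] <-]].
    by exists (i + j)%N => //; exact: GM.
  apply/seteqP; split; last first.
    by apply: gen_mono => _ [a [Ia _] [b [Jb _] <-]]; exists a => //; exists b.
  set P := ideal_gen _; have hP : is_ideal P by exact: ideal_genP.
  apply: mul_sub => // a b Ia Jb.
  suff : ideal_gen (I `&` \bigcup_i G i) `<=` colon_elt P b by apply; rewrite -eI.
  apply: gen_sub; first exact: ideal_colon_elt.
  move=> a' ha'; rewrite /colon_elt /= mulrC.
  suff : ideal_gen (J `&` \bigcup_i G i) `<=` colon_elt P a' by apply; rewrite -eJ.
  apply: gen_sub; first exact: ideal_colon_elt.
  move=> b' hb'; rewrite /colon_elt /= mulrC; apply: sub_gen.
  by exists a' => //; exists b'.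
- move=> I J [hI eI] [hJ eJ].
  rewrite (_ : ideal_add I J = ideal_gen ((I `|` J) `&` \bigcup_i G i)).
    by apply: homogeneous_gen => a [].
  apply/seteqP; split; last first.
    apply: gen_sub; first exact: ideal_addP.
    by move=> a [[Ia|Ja] _]; [exact: add_subl|exact: add_subr].
  apply: add_sub; first exact: ideal_genP.
    by rewrite {1}eI; apply: gen_mono => a [Ia Ga]; split=> //; left.
  by rewrite {1}eJ; apply: gen_mono => a [Ja Ga]; split=> //; right.
- by move=> s sV; apply: homogeneous_gen => a /sV Ga; exists 1%N.
- by rewrite graded_maximal; exact: sub_gen.
- by move=> a b; exact: GB.
- by move=> _ a [k _ <-]; exact: GZ.
- move=> r; have [k [b [Mb ->]]] := M_decomp r; exists (iota k); first by exists k.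
  by rewrite addrC addKr graded_maximal.
- move=> t; apply: contrapT => h; apply: inf.
  (* If [t] met the classes of all constants, [f] would embed [K] into [t], because [m] contains no
     nonzero constant. *)
  have /choice[f hf] : forall k : K, exists a, a \in t /\ m (iota k - a).
    move=> k; apply: contrapT => h'; apply: h; exists (iota k); first by exists k.
    by move=> a ta mka; apply: h'; exists a.
  have hm : is_ideal m by case: am.
  have finj : injective f.
    move=> k l fkl; apply/eqP; rewrite -subr_eq0; apply/eqP/graded_iota.
    have -> : iota (k - l) = (iota k - f k) - (iota l - f l) by rewrite fkl rmorphB; ring.
    by apply: idealB => //; [exact: (hf k).2|exact: (hf l).2].
  have /choice[g hg] : forall a, exists k, (exists l, f l = a) -> f k = a.
    move=> a; case: (pselect (exists l, f l = a)) => [[l <-]|ha]; first by exists l.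
    by exists 0.
  apply: (@sub_finite_set _ _ (g @` [set` t])); last exact/finite_image/finite_seq.
  move=> k _; exists (f k); first exact: (hf k).1.
  by apply: finj; apply: hg; exists k.
- have [s sG es] := noetherian_gen_seq (G 1%N).
  by exists s => //; rewrite graded_maximal.
Qed.

End GradedFrame.
End Frames.

(** * Free generators make [R] regular at [m] *)

Section RegularAt.
Context {R : comNzRingType} {m : set R} {adm : set (set R)} {V C : set R}.
Hypothesis fr : frame m adm V C.
Variable s : seq R.
Hypotheses (sV : [set` s] `<=` V) (ms : m = ideal_gen [set` s]) (free : form_free m s).

Let mprime : prime_ideal m := maximal_prime (frame_max fr).
Let mideal : is_ideal m := prime_ideal_ideal mprime.
Let sm : [set` s] `<=` m. Proof. by apply: subset_trans sV _; exact: (frame_Vm fr). Qed.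
Let L i := ideal_gen [set` take i s].
Let idealL i : is_ideal (L i). Proof. exact: ideal_genP. Qed.

Let colonX i k a : (i < size s)%N -> L i (a * s`_i ^+ k) -> L i a.
Proof.
move=> si; elim: k a => [|k ih] a; first by rewrite mulr1.
rewrite exprSr mulrA => h; apply: ih; apply: (form_free_colon fr sV ms free) h.
by rewrite leqnn.
Qed.

(** Divide [a] by [s_i] modulo [L i] as often as possible; Krull's intersection theorem stops the
    division. *)
Let factor i a : (i < size s)%N -> ~ L i a ->
  exists k r, ~ L i.+1 r /\ L i (a - r * s`_i ^+ k).
Proof.
move=> si La.
have [|[|k] [hk kmin]] := @least_exists
    (fun k => ~ ideal_add (L i) (multiples (s`_i ^+ k)) a).
- apply: contrapT => /forallNP h; apply: La; apply: (frame_krull fr).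
    by apply: (frame_gen fr) => b /= /mem_take; exact: sV.
  move=> d; have [l Ll [_ [r _ <-] <-]] := contrapT (h d); apply: mem_add => //.
  by apply: (idealMl (ideal_expP _ _)); apply: mem_expX; apply: sm; exact: mem_nth.
- case: hk; exists 0; first exact: (ideal0 (idealL i)).
  by exists a; [exists a; rewrite ?mulr1|rewrite add0r].
have [l Ll [_ [r _ <-] ea]] : ideal_add (L i) (multiples (s`_i ^+ k)) a.
  by apply: contrapT => /kmin; rewrite ltnn.
exists k, r; split; last by rewrite -ea addrK.
rewrite /L gen_take_S // => -[l' Ll' [_ [t _ <-] er]]; apply: hk.
exists (l + l' * s`_i ^+ k); first by apply: (idealD (idealL i)) => //; exact: (idealMr (idealL i)).
by exists (t * s`_i ^+ k.+1); [exists t|rewrite -ea -er exprS; ring].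
Qed.

(** After removing powers of [s_i], two elements outside [L i] have cofactors outside the prime
    [L i.+1], and [s_i] is a nonzerodivisor modulo [L i]. *)
Let prime_step i : (i < size s)%N -> prime_ideal (L i.+1) -> prime_ideal (L i).
Proof.
move=> si [hL L1 Lp].
have LS : L i `<=` L i.+1 by rewrite /L gen_take_S //; exact: add_subl.
split=> // [/LS//|a b Lab].
case: (pselect (L i a)) => La; [by left|right]; apply: contrapT => Lb.
have [k [r [Lr ar]]] := factor si La; have [l [t [Lt bt]]] := factor si Lb.
suff : L i (r * t * s`_i ^+ (k + l)) by move=> /(colonX si)/LS/Lp[].
have -> : r * t * s`_i ^+ (k + l) =
    a * b - (a - r * s`_i ^+ k) * b - (r * s`_i ^+ k) * (b - t * s`_i ^+ l).
  by rewrite exprD; ring.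
apply: (idealB (idealL i)); last exact: (idealMl (idealL i)).
by apply: (idealB (idealL i)) => //; exact: (idealMr (idealL i)).
Qed.

Lemma form_free_regular_at : regular_at m.
Proof.
have Ls : L (size s) = m by rewrite /L take_size ms.
have Lprime i : (i <= size s)%N -> prime_ideal (L i).
  move=> /subKn<-; elim: (size s - i)%N => [|j ih]; first by rewrite subn0 Ls.
  case: (ltnP j (size s)) => [js|sj].
    apply: prime_step; first by rewrite ltn_subrL /= (leq_ltn_trans _ js).
    by rewrite subnSK.
  move: ih; have /eqP-> : (size s - j == 0)%N by rewrite subn_eq0.
  by have /eqP-> : (size s - j.+1 == 0)%N by rewrite subn_eq0 leqW.
exists s; split=> //; last first.
  by move=> a ma; exists 1; [case: mprime|rewrite mul1r -ms].
split.
  exists L; split=> // i si; split; first by rewrite /L gen_take_S //; exact: add_subl.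
  move=> h; have : L i s`_i.
    by apply: h; rewrite /L gen_take_S //; apply: add_subr => //; exact: mem_multiples.
  rewrite -(mul1r s`_i) => /(form_free_colon fr sV ms free) L1.
  by have [_ + _] := Lprime i (ltnW si); apply; apply: L1; rewrite leqnn.
move=> k; apply: (height_theorem (frame_noetherian fr) mprime).
rewrite -ms; split=> // a ma; exists 1, 1%N; rewrite mul1r expr1; split=> //.
by case: mprime.
Qed.

End RegularAt.

(** * Regularity of polynomial rings *)

Section RegularRings.

(* Regularity of the localization at P up to the upper bound on the height,
   which is automatic in Noetherian rings. *)
Definition chain_generated (A : comNzRingType) (P : set A) : Prop :=
  exists s : seq A, [/\ prime_chain P (size s), [set` s] `<=` P
    & forall a, P a -> exists2 u, ~ P u & ideal_gen [set` s] (u * a)].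

Definition primes_chain_generated (A : comNzRingType) : Prop :=
  forall P : set A, prime_ideal P -> chain_generated P.

Lemma chain_generated_regular_at (A : comNzRingType) (P : set A) :
  noetherian A -> prime_ideal P -> chain_generated P -> regular_at P.
Proof.
move=> hA hP [s [chain sP sgen]]; exists s; split=> //; split=> // k.
apply: height_theorem => //; split.
  by apply: gen_sub => //; exact: prime_ideal_ideal.
by move=> a /sgen[u Pu su]; exists u, 1%N.
Qed.

Lemma field_chain_generated (A : comNzRingType) :
  (forall a : A, a <> 0 -> exists b, b * a = 1) -> primes_chain_generated A.
Proof.
move=> inv P hP; have hPi := prime_ideal_ideal hP.
have P0 a : P a -> a = 0.
  move=> Pa; apply: contrapT => /inv[b e]; case: hP => _ + _; apply.
  by rewrite -e; exact: idealMl.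
exists [::]; split=> //; first by exists (fun=> P).
move=> a /P0->; exists 1; first by case: hP.
by rewrite mulr0; exact: (ideal0 (ideal_genP _)).
Qed.

Lemma prime_preimage (A B : comNzRingType) (f : {rmorphism A -> B}) (P : set B) :
  prime_ideal P -> prime_ideal (f @^-1` P).
Proof.
move=> [hP P1 Pp]; split.
- split=> [|a b Pa Pb|r a Pa]; rewrite /preimage /=.
  + by rewrite rmorph0; exact: ideal0.
  + by rewrite rmorphD; exact: idealD.
  + by rewrite rmorphM; exact: idealMl.
- by rewrite /preimage /= rmorph1.
- by move=> a b; rewrite /preimage /= rmorphM => /Pp.
Qed.

Lemma iso_chain_generated (A B : comNzRingType) (f : {rmorphism A -> B}) (g : B -> A) :
  cancel f g -> cancel g f -> primes_chain_generated A -> primes_chain_generated B.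
Proof.
move=> fK gK hA P hP.
have finj : injective f := can_inj fK.
have gD a b : g (a + b) = g a + g b by apply: finj; rewrite rmorphD !gK.
have gM a b : g (a * b) = g a * g b by apply: finj; rewrite rmorphM !gK.
have g0 : g 0 = 0 by apply: finj; rewrite gK rmorph0.
have g1 : g 1 = 1 by apply: finj; rewrite gK rmorph1.
have gprime (Q : set A) : prime_ideal Q -> prime_ideal (g @^-1` Q).
  move=> [hQ Q1 Qp]; split.
  - split=> [|a b Qa Qb|r a Qa]; rewrite /preimage /=.
    + by rewrite g0; exact: ideal0.
    + by rewrite gD; exact: idealD.
    + by rewrite gM; exact: idealMl.
  - by rewrite /preimage /= g1.
  - by move=> a b; rewrite /preimage /= gM => /Qp.
have [s [[c [cp cS cP]] sP sgen]] := hA _ (prime_preimage f hP).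
exists (map f s); split.
- rewrite size_map; exists (fun i => g @^-1` c i); split=> [i /cp/gprime//|i /cS[h1 h2]|].
    split=> [a /h1//|h]; apply: h2 => a ca; rewrite -(fK a); apply: h.
    by rewrite /preimage /= fK.
  by rewrite cP; apply/seteqP; split=> a; rewrite /preimage /= gK.
- by move=> _ /= /mapP[a sa ->]; exact: (sP a).
- move=> a Pa; have [|u Pu su] := sgen (g a); first by rewrite /preimage /= gK.
  exists (f u) => //; rewrite -[a]gK -rmorphM.
  have h : is_ideal (f @^-1` ideal_gen [set` map f s]).
    split=> [|b d Pb Pd|r b Pb]; rewrite /preimage /=.
    + by rewrite rmorph0; exact: (ideal0 (ideal_genP _)).
    + by rewrite rmorphD; exact: (idealD (ideal_genP _)).
    + by rewrite rmorphM; exact: (idealMl (ideal_genP _)).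
  apply: (gen_sub h _ su) => b /= sb; apply: sub_gen; exact: map_f.
Qed.

Section Poly.
Variable A : comNzRingType.

Definition poly_ext (c : set A) : set {poly A} := [set p | forall i, c p`_i].

Lemma poly_extP c : is_ideal c -> is_ideal (poly_ext c).
Proof.
move=> hc; split=> [i|p q hp hq i|r p hp i].
- by rewrite coef0; exact: ideal0.
- by rewrite coefD; exact: idealD.
- by rewrite coefM; apply: ideal_sum => // j _; exact: idealMl.
Qed.

(** As in Gauss's lemma: the product of the lowest coefficients outside [c], in degrees [i] and [j],
    is the only term of the coefficient of degree [i + j] not already in [c]. *)
Lemma poly_ext_prime c : prime_ideal c -> prime_ideal (poly_ext c).
Proof.
move=> hc; have hci := prime_ideal_ideal hc; split; first exact: poly_extP.
  by move=> /(_ 0%N); rewrite coef1; case: hc.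
have low p : ~ poly_ext c p -> exists n, ~ c p`_n /\ forall i, (i < n)%N -> c p`_i.
  move=> /existsNP hp; have [n [cn nmin]] := least_exists hp.
  exists n; split=> // i i_n; apply: contrapT => /nmin; by rewrite leqNgt i_n.
move=> p q pq; case: (pselect (poly_ext c p)) => hp; [by left|right].
apply: contrapT => hq; have [i [pi plt]] := low p hp; have [j [qj qlt]] := low q hq.
apply: (primeM hc pi qj); have := pq (i + j)%N.
have ii : (i < (i + j).+1)%N by rewrite ltnS leq_addr.
rewrite coefM (bigD1 (Ordinal ii)) //= addKn; apply: idealDr => //.
apply: ideal_sum => // k ki.
have [lt_ki|ge_ki] := ltnP k i; first by apply: idealMr => //; exact: plt.
apply: idealMl => //; apply: qlt; rewrite ltn_subLR; last by rewrite -ltnS.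
rewrite ltn_add2r ltn_neqAle ge_ki andbT eq_sym; exact: ki.
Qed.

Lemma gen_map_polyC (s : seq A) a :
  ideal_gen [set` s] a -> ideal_gen [set` map polyC s] a%:P.
Proof.
apply: (@gen_sub _ _ [set a | ideal_gen [set` map polyC s] a%:P]) => [|b /= sb].
  split=> [|x y hx hy|r x hx] /=.
  - by rewrite polyC0; exact: (ideal0 (ideal_genP _)).
  - by rewrite polyCD; exact: (idealD (ideal_genP _)).
  - by rewrite polyCM; exact: (idealMl (ideal_genP _)).
by apply: sub_gen; rewrite /= map_f.
Qed.

(* The fibre of Spec A[X] over a prime q of A is the spectrum of the principal
   ring k(q)[X]: locally Q is q A[X], or generated by q and one polynomial f. *)
Lemma poly_chain_generated : primes_chain_generated A -> primes_chain_generated {poly A}.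
Proof.
move=> hA Q hQ; have hQi := prime_ideal_ideal hQ.
pose q : set A := polyC @^-1` Q.
have hq : prime_ideal q by exact: (@prime_preimage _ _ polyC Q hQ).
have hqi := prime_ideal_ideal hq; have hqX := poly_extP hqi.
have [s [[c [cp cS cq]] sq sgen]] := hA q hq.
have q_default (p : {poly A}) i : (size p <= i)%N -> q p`_i.
  by move=> pi; rewrite nth_default //; exact: ideal0.
have qQ : poly_ext q `<=` Q.
  move=> p hp; rewrite -[p]coefK poly_def; apply: (ideal_sum hQi) => i _.
  by rewrite -mul_polyC; apply: (idealMr hQi); exact: hp.
have sQ : [set` map polyC s] `<=` Q by move=> _ /= /mapP[a sa ->]; exact: (sq a).
have extS i : (i < size s)%N -> poly_ext (c i) `<` poly_ext (c i.+1).
  move=> si; have [h1 h2] := cS i si; split=> [p hp j|h]; first exact/h1/hp.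
  apply: h2 => a ca; have /h/(_ 0%N) : poly_ext (c i.+1) a%:P; last by rewrite coefC.
  move=> j; rewrite coefC; case: ifP => // _.
  by apply: ideal0; apply: prime_ideal_ideal; exact: cp.
have ext_prime i : (i <= size s)%N -> prime_ideal (poly_ext (c i)).
  by move=> /cp; exact: poly_ext_prime.
have ext_gen p : poly_ext q p ->
    exists2 u, ~ q u & ideal_gen [set` map polyC s] (u%:P * p).
  move=> hp; have /choice[u hu] : forall i, exists u, ~ q u /\ ideal_gen [set` s] (u * p`_i).
    by move=> i; have [u qu su] := sgen _ (hp i); exists u.
  exists (\prod_(i < size p) u i); first by apply: prime_prod => // i; exact: (hu i).1.
  rewrite -[p in _ * p]coefK poly_def mulr_sumr; apply: (ideal_sum (ideal_genP _)) => i _.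
  rewrite -mul_polyC mulrA -polyCM; apply: (idealMr (ideal_genP _)).
  apply: gen_map_polyC; rewrite (bigD1 i) //= mulrAC; apply: (idealMr (ideal_genP _)).
  exact: (hu i).2.
case: (pselect (Q `<=` poly_ext q)) => [Qq|Qq].
  have eQ : poly_ext q = Q by apply/seteqP.
  exists (map polyC s); split=> //.
    rewrite size_map; exists (fun i => poly_ext (c i)); split=> //.
    by rewrite cq.
  by move=> p /Qq/ext_gen[u qu su]; exists u%:P.
(* [n] is the least degree modulo [q] among the elements of [Q] outside [q A[X]], attained by
   [f]. *)
have [|n [[f [Qf fn flt]] nmin]] := @least_exists (fun n => exists f : {poly A},
    [/\ Q f, ~ q f`_n & forall i, (n < i)%N -> q f`_i]).
  have [f [Qf /existsNP[k fk]]] : exists f, Q f /\ ~ poly_ext q f.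
    by apply: contrapT => h; apply: Qq => f Qf; apply: contrapT => qf; apply: h; exists f.
  have [N [sN Nmin]] := @least_exists (fun N => forall i, (N <= i)%N -> q f`_i)
    (ex_intro _ (size f) (q_default f)).
  case: N sN Nmin => [/(_ k (leq0n k))//|N] sN Nmin; exists N, f; split=> // fN.
  have /Nmin : forall i, (N <= i)%N -> q f`_i; last by rewrite ltnn.
  by move=> i; rewrite leq_eqVlt => /orP[/eqP<-//|]; exact: sN.
have low p N : Q p -> (forall i, (N <= i)%N -> q p`_i) -> (N <= n)%N -> poly_ext q p.
  move=> Qp hp Nn; apply: contrapT => /existsNP[k pk].
  have [[|N'] [h hmin]] := @least_exists (fun N => forall i, (N <= i)%N -> q p`_i)
    (ex_intro _ N hp); first exact: (pk (h k (leq0n k))).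
  have N'N : (N'.+1 <= N)%N by exact: hmin.
  have qN' : ~ q p`_N'.
    move=> qN'; have /hmin : forall i, (N' <= i)%N -> q p`_i; last by rewrite ltnn.
    by move=> i; rewrite leq_eqVlt => /orP[/eqP<-//|]; exact: h.
  have /nmin : exists p : {poly A}, [/\ Q p, ~ q p`_N' & forall i, (N' < i)%N -> q p`_i].
    by exists p.
  by rewrite leqNgt (leq_trans N'N).
(* Pseudo-division modulo [q]: each step multiplies by the leading coefficient of [f], which is
   outside [q]. The remainder has degree below [n] modulo [q], so it lies in [q A[X]] by [low]. *)
have divide N p : Q p -> (forall i, (N <= i)%N -> q p`_i) ->
    exists u d, ~ q u /\ poly_ext q (u%:P * p - d * f).
  elim: N p => [|N ih] p Qp hp.
    exists 1, 0; rewrite mul1r mul0r subr0; split; first by case: hq.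
    exact: (low p 0%N).
  case: (leqP N.+1 n) => [Nn|nN].
    exists 1, 0; rewrite mul1r mul0r subr0; split; first by case: hq.
    exact: (low p N.+1).
  rewrite ltnS in nN.
  pose p' := (f`_n)%:P * p - (p`_N)%:P * (f * 'X^(N - n)).
  have [||u [d [qu hd]]] := ih p'.
  - by apply: (idealB hQi); [exact: (idealMl hQi)|apply: (idealMl hQi); exact: (idealMr hQi)].
  - move=> i; rewrite coefB !coefCM coefMXn leq_eqVlt => /orP[/eqP<-|Ni].
      rewrite ltnNge leq_subr /= subKn // mulrC subrr; exact: ideal0.
    apply: (idealB hqi); apply: (idealMl hqi); first exact: hp.
    case: ifP => _; first exact: ideal0.
    by apply: flt; rewrite ltn_subRL subnK.
  exists (u * f`_n), (u%:P * (p`_N)%:P * 'X^(N - n) + d); split; first exact: primeM.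
  have -> : (u * f`_n)%:P * p - (u%:P * (p`_N)%:P * 'X^(N - n) + d) * f = u%:P * p' - d * f.
    by rewrite polyCM /p'; ring.
  exact: hd.
exists (f :: map polyC s); split.
(* Putting [Q] on top of the extended chain accounts for the additional generator [f]. *)
- rewrite /= size_map; exists (fun i => if (i <= size s)%N then poly_ext (c i) else Q).
  split=> [i _|i|]; last by rewrite ltnn.
    by case: ifP => // /ext_prime.
  rewrite ltnS => si; rewrite si; case: ltnP => [/extS//|ngt].
  have -> : i = size s by apply/eqP; rewrite eqn_leq si ngt.
  by rewrite cq; split.
- by move=> p; rewrite /= inE => /orP[/eqP->|/sQ].
move=> p Qp; have [u [d [qu hd]]] := divide (size p) p Qp (q_default p).
have [w qw sw] := ext_gen _ hd.
exists (w * u)%:P; first by apply: (primeM hq).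
have -> : (w * u)%:P * p = w%:P * (u%:P * p - d * f) + (w%:P * d) * f.
  by rewrite polyCM; ring.
apply: (idealD (ideal_genP _)); last first.
  by apply: (idealMl (ideal_genP _)); apply: sub_gen; rewrite /= mem_head.
by apply: gen_mono sw => b /= sb; rewrite inE sb orbT.
Qed.

End Poly.
End RegularRings.

Section MPolyChain.
Context {K : fieldType}.

Lemma muni_mwiden n (p : {mpoly K[n]}) : muni (mwiden p) = p%:P.
Proof.
elim/mpolyind: p => [|c k p _ _ ih]; first by rewrite mwiden0 muni0 polyC0.
rewrite mwidenD muniD ih polyCD mwidenZ muniZ mwidenX muniE msuppX big_seq1 mcoeffX eqxx.
rewrite scale1r mnmwiden_ordmax expr0 -!mul_polyC mulr1 -polyCM mul_mpolyC.
congr ((_ *: 'X_[_])%:P + _); apply/mnmP => i.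
by rewrite mnmE mnmwiden_widen.
Qed.

Lemma muni_ord_max n : muni ('X_ord_max : {mpoly K[n.+1]}) = 'X.
Proof.
rewrite muniE msuppX big_seq1 mcoeffX eqxx scale1r mnm1E eqxx expr1.
rewrite (_ : [multinom _ | i < n] = 0%MM) ?mpolyX0 ?scale1r //.
apply/mnmP => i; rewrite mnmE mnm0E mnm1E; apply/eqP; rewrite eqb0.
by rewrite -val_eqE /= gtn_eqF.
Qed.

Lemma ununiK n : cancel (@ununi K n) (@muni n K).
Proof.
move=> p; rewrite /ununi horner_coef raddf_sum /= -[RHS]coefK poly_def.
rewrite (size_map_inj_poly (@inj_mwiden n K)) ?mwiden0 //.
apply: eq_bigr => i _; rewrite coef_map /= muniM muni_mwiden rmorphXn /= muni_ord_max.
by rewrite mul_polyC.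
Qed.

Lemma mpoly_chain_generated n : primes_chain_generated {mpoly K[n]}.
Proof.
elim: n => [|n ih].
  apply: field_chain_generated => a a0; have ha : a = (a@_0%MM)%:MP.
    by apply: dhomog0_const; apply/dhomogP => k _; rewrite /= mdegE big_ord0.
  exists (a@_0%MM)^-1%:MP; rewrite {2}ha -mpolyCM mulVf //.
  by apply/eqP => e; apply: a0; rewrite ha e mpolyC0.
have cfu : commr_rmorph (@mwiden n K) 'X_ord_max by move=> x; exact: mulrC.
exact: (@iso_chain_generated _ _ (horner_morph cfu) (@muni n K) (@ununiK n) (@muniK _ n)
  (poly_chain_generated ih)).
Qed.

End MPolyChain.

(** * In the graded case free generators identify [R] with a polynomial ring *)

Section GradedRegular.
Context {K : fieldType} {R : comNzRingType} {iota : {rmorphism K -> R}} {G : nat -> set R}.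
Variable m : set R.
Hypotheses (hR : noetherian R) (sg : standard_graded iota G)
  (um : unique_maximal (homogeneous_ideal G) m) (inf : infinite_set [set: K]).
Variable s : seq R.
Hypotheses (sV : [set` s] `<=` G 1%N) (ms : m = ideal_gen [set` s]) (free : form_free m s).

Let fr := graded_frame hR sg um inf.
Let n := size s.
Let phi : {mpoly K[n]} -> R := mmap iota (fun i => s`_i).

Let evE (p : {mpoly K[n]}) : phi p = ev (map_mpoly iota p).
Proof.
rewrite /ev mevalE (perm_big _ (msupp_map_mpoly p (fmorph_inj iota))) /=.
by apply: eq_bigr => k _; rewrite mcoeff_map_mpoly.
Qed.

Let map_dhomog (p : {mpoly K[n]}) d : p \is d.-homog for mdeg ->
  map_mpoly iota p \is d.-homog for mdeg.
Proof.
move=> /dhomogP hp; apply/dhomogP => k.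
by rewrite (perm_mem (msupp_map_mpoly p (fmorph_inj iota))) => /hp.
Qed.

Let phi_G d (p : {mpoly K[n]}) : p \is d.-homog for mdeg -> G d (phi p).
Proof.
have [GV _ _ _ [eG0 _]] := sg.
have G1 : G 0%N 1 by rewrite eG0 -(rmorph1 iota); exists 1.
have GD i a b : G i a -> G i b -> G i (a + b) by have [_ h _] := GV i; apply: h.
have GM i j a b := @graded_mul _ _ _ _ sg i j a b.
move=> /dhomogP hp; rewrite /phi /mmap big_seq_cond.
elim/big_ind: _ => [||k /andP[/hp /= <- _]]; [by have [] := GV d|exact: GD|].
have [_ _ GZ] := GV (mdeg k); apply: GZ; rewrite /mmap1 mdegE.
elim/big_ind2: _ => // [a i b j|i _]; first exact: GM.
elim: (k i) => // e ih; rewrite exprS -add1n; apply: GM => //.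
by apply: sV; exact: mem_nth.
Qed.

(** [phi] respects degrees, so its kernel is homogeneous; freeness puts the coefficients of
    homogeneous kernel elements into [m], and the only constant there is 0. *)
Let phi_inj : injective phi.
Proof.
move=> p q epq; apply/eqP; rewrite -subr_eq0; apply/eqP.
have : phi (p - q) = 0 by rewrite /phi rmorphB /= -!/(phi _) epq subrr.
move: (p - q) => {epq}p.
rewrite {1}(pihomog_partitionE (leqnn (mmeasure mdeg p))) /phi rmorph_sum /= => h.
rewrite (pihomog_partitionE (leqnn (mmeasure mdeg p))); apply: big1 => d _.
have hd := pihomogP mdeg d p.
have phid : phi (pihomog mdeg d p) = 0.
  apply: (graded_sum_eq0 sg (c := fun d => phi (pihomog mdeg d p)) _ h) => // d'.
  by apply: phi_G; exact: pihomogP.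
have := free (map_dhomog hd); rewrite -evE phid => /(_ erefl) mp.
apply/mpolyP => k; rewrite mcoeff0; apply: (graded_iota sg um).
by rewrite -mcoeff_map_mpoly; exact: mp.
Qed.

(** The image is a subalgebra, so it only has to contain [G 1]. Reducing coefficients to constants
    changes a linear form by an element of [m^2] of degree 1, which is 0. *)
Let phi_surj a : exists p, phi p = a.
Proof.
apply: (graded_subalgebra sg (A := [set a | exists p, phi p = a])).
  split=> [k|_ _ [p <-] [q <-]|_ _ [p <-] [q <-]].
  - by exists k%:MP; rewrite /phi mmapC.
  - by exists (p + q); rewrite /phi rmorphD.
  - by exists (p * q); rewrite /phi rmorphM.
move=> g Gg; have mideal : is_ideal m by case: um => -[].
have sm (i : 'I_n) : m s`_i by apply: (frame_Vm fr); apply: sV; exact: mem_nth.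
have /gen_seqP[c eg] : ideal_gen [set` s] g by rewrite -ms; exact: (frame_Vm fr).
have /choice[e he] : forall i, exists k, m (c i - iota k).
  by move=> i; have [_ [k _ <-] mk] := frame_C fr (c i); exists k.
pose p : {mpoly K[n]} := \sum_i e i *: 'X_i.
have hp : p \is 1.-homog for mdeg.
  by apply: rpred_sum => i _; apply: dhomogZ; rewrite dhomogX; apply/eqP; exact: mdeg1.
exists p; apply/eqP; rewrite -subr_eq0; apply/eqP.
apply: (graded_mul_m_degree1 sg um); first exact: (frame_VB fr (phi_G hp) Gg).
have -> : phi p = \sum_i iota (e i) * s`_i.
  by rewrite /phi rmorph_sum; apply: eq_bigr => i _; rewrite /= mmapZ mmapX mmap1U.
rewrite eg -sumrB; apply: (ideal_sum (ideal_mulP _ _)) => i _.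
rewrite -mulrBl; apply: mem_mul => //.
by rewrite -opprB; apply: idealN.
Qed.

Lemma graded_regular : regular R.
Proof.
have /choice[g gK] := phi_surj.
have phiK : cancel phi g by move=> p; apply: phi_inj; rewrite gK.
move=> P mP; have hP := maximal_prime mP.
apply: chain_generated_regular_at => //.
exact: (@iso_chain_generated _ _ (mmap iota (fun i => s`_i) : {rmorphism {mpoly K[n]} -> R})
  g phiK gK (@mpoly_chain_generated K n) P hP).
Qed.

End GradedRegular.

(** * From the conditions of the theorem to free generators *)

Section FreeGenerators.
Context {R : comNzRingType} {m : set R} {adm : set (set R)} {V C : set R}.
Hypothesis fr : frame m adm V C.

Let mmax : maximal_ideal m := frame_max fr.
Let mprime : prime_ideal m := maximal_prime mmax.
Let mideal : is_ideal m := prime_ideal_ideal mprime.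

Definition free_generators s := [/\ [set` s] `<=` V, m = ideal_gen [set` s] & form_free m s].

(** The [d]-sequence need not lie in [V], hence the passage to a shortest generating sequence in
    [V]. *)
Lemma d_sequence_free_generators s : d_sequence s -> m = ideal_gen [set` s] ->
  exists x, free_generators x.
Proof.
move=> ds ms; have [x [xV mx xmin]] := exists_minimal_gens fr.
exists x; split=> //; apply: (d_sequence_form_free ds) => // c.
exact: (minimal_gens_independent fr).
Qed.

Lemma minimal_reduction_free_generators :
  (forall I, minimal_reduction adm m I -> I = m) -> exists x, free_generators x.
Proof.
move=> h; have [I mI] := exists_minimal_reduction fr.
(* Since a minimal reduction exists, the hypothesis is not vacuous and [m] has no smaller
   reduction. *)
have [_ mmin] : minimal_reduction adm m m by rewrite -[X in minimal_reduction _ _ X](h I mI).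
have [x [xV mx xmin]] := exists_minimal_gens fr.
exists x; split=> // d F hF F0; apply: contrapT => mF.
have [z [zV zx zred]] := reduction_relation fr xV mx hF F0 mF.
have : (size x <= size z)%N; last by rewrite leqNgt zx.
by apply: xmin => //; apply/esym/mmin => //; case: zred.
Qed.

(** The local generators are first replaced by elements of [V] congruent to them modulo [m^2];
    saturation and Nakayama show that these generate [m] itself. *)
Lemma regular_free_generators : regular_at m -> exists x, free_generators x.
Proof.
move=> [s [[chain _] sm sgen]].
have /choice[f hf] : forall a, exists v, m a -> V v /\ ideal_mul m m (a - v).
  move=> a; case: (pselect (m a)) => [ma|]; last by exists 0.
  by have [v Vv mv] := frame_approx fr ma; exists v.
pose x := map f s.
have xV : [set` x] `<=` V by move=> _ /= /mapP[a /sm/hf[Vfa _] ->].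
have xm : ideal_gen [set` x] `<=` m.
  by apply: gen_sub => // a /xV; exact: (frame_Vm fr).
have mx : m = ideal_gen [set` x].
  apply/seteqP; split=> //; apply: (frame_nakayama fr) => //; first exact: (frame_gen fr).
  have aX : adm (ideal_add (ideal_gen [set` x]) (ideal_mul m m)).
    apply: (frame_add fr); first exact: (frame_gen fr).
    by apply: (frame_mul fr); exact: (frame_m fr).
  move=> a ma; have [u mu su] := sgen a ma; apply: (frame_sat fr aX mu).
  move: su; apply: gen_sub; first exact: (frame_ideal fr).
  move=> b /= sb; have [Vb mb] := hf b (sm b sb); exists (f b).
    by apply: sub_gen; exact: map_f.
  by exists (b - f b) => //; rewrite addrC subrK.
exists x; split=> // d F hF F0; apply: contrapT => mF.
(* [m^(r+1)] lies in [(z)], so [m] is minimal over an ideal with fewer generators than its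
   height. *)
have [z [zV zx [_ zm [r zr]]]] := reduction_relation fr xV mx hF F0 mF.
have : (size s <= size z)%N; last by rewrite leqNgt -(size_map f s) zx.
apply: (height_theorem (frame_noetherian fr) mprime) chain.
split=> // a ma; exists 1, r.+1; rewrite mul1r; split; first by case: mprime.
apply: (mul_subl (J := ideal_exp m r) (ideal_genP _)); rewrite zr.
exact: mem_expX.
Qed.

Lemma free_generators_gt0 s : depth_gt0 m -> free_generators s -> (0 < size s)%N.
Proof.
move=> [y my yreg] [_ ms _]; rewrite lt0n; apply/eqP => /size0nil s0.
have y0 : y = 0.
  move: my; rewrite ms s0; apply: (@gen_sub _ _ [set 0] ideal_zero) => a; by rewrite /= in_nil.
by have := yreg 1; rewrite y0 mul0r => /(_ erefl)/eqP; rewrite oner_eq0.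
Qed.

End FreeGenerators.

(** Regularity concerns all maximal ideals: in the local case only [m], in the graded case also the
    inhomogeneous ones. So that conclusion is drawn in each setting separately. *)
Lemma setting_frame (R : comNzRingType) (m : set R) (adm : set (set R)) :
  setting m adm -> exists V C, frame m adm V C /\
    forall s : seq R, [set` s] `<=` V -> m = ideal_gen [set` s] -> form_free m s -> regular R.
Proof.
case=> [hR um inf|K iota G hR sg um inf].
  have fr := local_frame hR um inf; exists m, setT; split=> // s sV ms free P mP.
  have -> : P = m by case: um => _ _ uniq; apply: uniq => //; case: mP.
  exact: (form_free_regular_at fr sV ms free).
exists (G 1%N), (range iota); split; first exact: graded_frame.
by move=> s sV ms free; exact: (graded_regular hR sg um inf sV ms free).
Qed.

Theorem theorem5p3 (R : comNzRingType) (m : set R) (adm : set (set R))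
    (hR : setting m adm) (hdepth : depth_gt0 m) :
  [<-> (* a *)
       regular R;
       (* b *)
       exists2 s : seq R, d_sequence s & m = ideal_gen [set` s];
       (* c *)
       s_number m 1 /\
         (forall I, reduction adm m I -> reduction_number m I 0);
       s_number m 1 /\
         (forall I, minimal_reduction adm m I -> reduction_number m I 0);
       (* d *)
       forall I, reduction adm m I ->
         [/\ dao1 m I 0, dao2 m I 0 & dao3 m I 0];
       forall I, minimal_reduction adm m I ->
         [/\ dao1 m I 0, dao2 m I 0 & dao3 m I 0];
       (* e *)
       forall I, reduction adm m I -> dao3 m I 0;
       forall I, minimal_reduction adm m I -> dao3 m I 0;
       (* f *)
       forall I, reduction adm m I -> rees_colon_eq m I;
       forall I, minimal_reduction adm m I -> rees_colon_eq m I].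
Proof.
have [V [C [fr freg]]] := setting_frame hR.
have mideal : is_ideal m := prime_ideal_ideal (maximal_prime (frame_max fr)).
have redI I : reduction adm m I -> is_ideal I by case=> aI _ _; exact: (frame_ideal fr).
have free_dao s : @free_generators _ m V s -> forall I, reduction adm m I ->
    [/\ dao1 m I 0, dao2 m I 0 & dao3 m I 0].
  move=> fs; have s0 := free_generators_gt0 hdepth fs; case: fs => sV ms free I.
  exact: (form_free_dao fr sV ms free s0).
have dao3_free : (forall I, minimal_reduction adm m I -> dao3 m I 0) ->
    exists s, @free_generators _ m V s.
  move=> h; apply: (minimal_reduction_free_generators fr) => I minI.
  have hI := redI I minI.1; apply: (weakly_full_reduction mideal minI.1 hI).
  exact/(dao3_eq0P mideal hI)/h.
tfae.
- move=> reg; have [s [sV ms free]] := regular_free_generators fr (reg m (frame_max fr)).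
  by exists s => //; exact: (form_free_d_sequence fr sV ms free).
- move=> [s ds ms]; have [x fx] := d_sequence_free_generators fr ds ms.
  have x0 := free_generators_gt0 hdepth fx; case: fx => xV mx free.
  split=> [|I]; first exact: (form_free_s_number fr xV mx free x0).
  exact: (form_free_reduction_number fr xV mx free).
- by move=> [hs h]; split=> // I [/h].
(* Reduction number 0 means [I = m], so [m] is its only minimal reduction. *)
- move=> [_ h]; have [|s fs] := minimal_reduction_free_generators fr; last exact: free_dao fs.
  move=> I minI; have [+ _] := h I minI.
  by rewrite ideal_exp1 // ideal_mulr1 //; exact: redI minI.1.
- by move=> h I [/h].
- by move=> h; have [|s /free_dao hs] := dao3_free; [move=> I /h[]|move=> I /hs[]].
- by move=> h I [/h].
- move=> /dao3_free[s /free_dao hs] I rI; have [_ _ d3] := hs I rI.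
  exact/(rees_colon_eqP hdepth (redI I rI))/(dao3_eq0P mideal (redI I rI)).
- by move=> h I [/h].
(* The cycle closes: the colon equations make every minimal reduction equal to [m], and the
   resulting free generators make [R] regular. *)
- move=> h; have [|s [sV ms free]] := dao3_free; last exact: (freg s).
  move=> I minI; have hI := redI I minI.1.
  exact/(dao3_eq0P mideal hI)/(rees_colon_eqP hdepth hI)/h.
Qed.
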